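(* Let $k<d$, $\mu>0$, and let $\mathcal{C}=\{(M_1,\dots,M_k): M_i\in\mathbb{R}^{d\times d}\text{ symmetric},\ 0\preceq M_i\preceq\mu I\ \forall i\}$. Let $\bar c=(\bar M_1,\dots,\bar M_k)\in\mathcal{C}$ be such that $\bar M_1,\dots,\bar M_k$ are jointly diagonalizable and the associated assignment LP of $\bar c$ has a unique optimal solution. Then there exists a full-dimensional neighborhood $\bar{\mathcal{C}}$ of $\bar c$ in $\mathcal{C}$ such that for all $c=(M_1,\dots,M_k)\in\bar{\mathcal{C}}$ the semidefinite program (SDP-P) with objective coefficients $c$ has the rank-one property.
   Context: For symmetric $M_1,\dots,M_k\in\mathbb{R}^{d\times d}$, (SDP-P) is the problem $$\max_{X_1,\dots,X_k}\ \mathrm{tr}\Big(\sum_{i=1}^kM_iX_i\Big)\quad\text{s.t. }\ \sum_{i=1}^kX_i\preceq I,\quad \mathrm{tr}(X_i)=1,\quad X_i\succeq0,\quad i=1,\dots,k,$$ over symmetric $d\times d$ matrices $X_i$. A feasible solution $(X_1,\dots,X_k)$ has the rank-one property if all $X_i$ have rank one; (SDP-P) is said to have the rank-one property if its optimal solutions have the rank-one property. Jointly diagonalizable means: there is one orthogonal matrix $Q$ with $Q'\bar M_iQ=\mathrm{diag}(\bar m_i)$, $\bar m_i\in\mathbb{R}^d$, for all $i$. The associated LP (obtained from the resulting diagonal SDP) is the assignment problem $$\max\Big\{\sum_{i=1}^k\bar m_i'x_i:\ x_i\in\mathbb{R}^d,\ x_i\ge0,\ \mathbf 1'x_i=1\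 (i=1,\dots,k),\ \sum_{i=1}^kx_i\le\mathbf 1\Big\},$$ where $\mathbf 1$ is the all-ones vector. $\mathcal{C}$ is viewed as a subset of the space of $k$-tuples of symmetric $d\times d$ matrices, and a full-dimensional neighborhood of $\bar c$ in $\mathcal{C}$ is a subset of $\mathcal{C}$ that contains $\bar c$, is relatively open in $\mathcal{C}$ and has nonempty interior in that space. *)

(* Defs.v *)
From HB Require Import structures.
From mathcomp Require Import all_boot all_order all_algebra.
From mathcomp Require Import all_classical all_reals all_analysis.

Set Implicit Arguments.
Unset Strict Implicit.
Unset Printing Implicit Defensive.

Import Order.TTheory GRing.Theory Num.Theory.
Import numFieldNormedType.Exports.

Local Open Scope classical_set_scope.
Local Open Scope ring_scope.

Definition psdmx (R : realType) (d : nat) (A : 'M[R]_d) : Prop :=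
  A^T = A /\ forall v : 'cV[R]_d, 0 <= (v^T *m A *m v) 0 0.

(* Loewner order. *)
Definition lemx (R : realType) (d : nat) (A B : 'M[R]_d) : Prop :=
  psdmx (B - A).

Definition sdp_feasible (R : realType) (k d : nat) (X : 'I_k -> 'M[R]_d) : Prop :=
  [/\ lemx (\sum_i X i) 1%:M,
      forall i, \tr (X i) = 1
    & forall i, psdmx (X i)].

Definition sdp_obj (R : realType) (k d : nat) (M X : 'I_k -> 'M[R]_d) : R :=
  \tr (\sum_i M i *m X i).

Definition sdp_optimal (R : realType) (k d : nat) (M X : 'I_k -> 'M[R]_d) : Prop :=
  sdp_feasible X /\
  forall Y, sdp_feasible Y -> sdp_obj M Y <= sdp_obj M X.

(* The feasible set is compact, so a feasible problem attains its optimum. *)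
Definition sdp_rank_one_property (R : realType) (k d : nat)
    (M : 'I_k -> 'M[R]_d) : Prop :=
  forall X, sdp_optimal M X -> forall i, \rank (X i) = 1%N.

Definition orthogonal_mx (R : realType) (d : nat) (Q : 'M[R]_d) : Prop :=
  Q^T *m Q = 1%:M.

Definition jointly_diagonalized (R : realType) (k d : nat) (M : 'I_k -> 'M[R]_d)
    (Q : 'M[R]_d) (m : 'I_k -> 'cV[R]_d) : Prop :=
  orthogonal_mx Q /\ forall i, Q^T *m M i *m Q = diag_mx (m i)^T.

Definition lp_feasible (R : realType) (k d : nat) (x : 'I_k -> 'cV[R]_d) : Prop :=
  [/\ forall i j, 0 <= x i j 0,
      forall i, \sum_j x i j 0 = 1
    & forall j, (\sum_i x i) j 0 <= 1].

Definition lp_obj (R : realType) (k d : nat) (m x : 'I_k -> 'cV[R]_d) : R :=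
  \sum_i ((m i)^T *m x i) 0 0.

Definition lp_optimal (R : realType) (k d : nat) (m x : 'I_k -> 'cV[R]_d) : Prop :=
  lp_feasible x /\
  forall y, lp_feasible y -> lp_obj m y <= lp_obj m x.

(* k-tuples of matrices with the product topology. *)
Notation mxtuple R k d := {ptws 'I_k -> 'M[R]_d}.

Definition symtuples (R : realType) (k d : nat) : set (mxtuple R k d) :=
  [set M | forall i, (M i)^T = M i].
Arguments symtuples R k d : clear implicits.

Definition coefset (R : realType) (k d : nat) (mu : R) : set (mxtuple R k d) :=
  [set M | forall i, [/\ (M i)^T = M i, lemx 0 (M i) & lemx (M i) mu%:M]].
Arguments coefset {R} k d mu _.

(* In `subspace A` the points outside A are isolated; this is harmless below
   because N is contained in C, and C is required to consist of symmetric
   tuples. *)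
Definition full_dim_nbhd (R : realType) (k d : nat) (C : set (mxtuple R k d))
    (c : mxtuple R k d) (N : set (mxtuple R k d)) : Prop :=
  [/\ C `<=` symtuples R k d, N `<=` C, N c,
      @open (subspace C) N
    & @interior (subspace (symtuples R k d)) N !=set0].

(* Main.v *)
Require Import Defs.
From mathcomp Require Import all_boot all_order all_algebra.
From mathcomp Require Import all_classical all_reals all_analysis.
From mathcomp Require Import ring lra zify.
Import Order.TTheory GRing.Theory Num.Theory.
Import numFieldNormedType.Exports.
Local Open Scope ring_scope.

Set Implicit Arguments.
Unset Strict Implicit.
Unset Printing Implicit Defensive.

(** In the eigenbasis [Q] the unique optimum of the assignment LP is an injective
assignment [sigma], and uniqueness yields a strictly complementary dual solution
[y]: positive on the image of [sigma], zero elsewhere, with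
[y_j - y_(sigma i) > m_ij - m_(i, sigma i)] for [j != sigma i].  For objective
matrices [N_i] close to the diagonal ones, maximise [sum_i u_i' N_i u_i] over
orthonormal frames [(u_i)] and put [P_i = u_i u_i'].  Optimality of [sigma] forces
[P_i] to be close to [e_(sigma i) e_(sigma i)'], and stationarity says that
[sum_i N_i P_i] is symmetric, so that
  [Y = sum_i ((1 - P_i) N_i P_i + y_(sigma i) P_i)],
  [S_i = Y + (tr (P_i N_i) - y_(sigma i)) I - N_i]
are symmetric, satisfy [S_i P_i = 0] and [Y (sum_i P_i) = Y], and converge to the
strictly complementary diagonal dual solution.  Hence [Y >= 0] and [S_i >= 0] with
kernel exactly the line of [u_i], and complementary slackness confines every
optimal [X_i] to that line.  The diagonal of the dual multiplier is not determined
by the frame; taking it from [y] is what keeps strict complementarity, although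
the dual solution is never unique when [k > 0]. *)

(** * Strict linear inequalities and the assignment LP *)

(** Nonempty positive combinations of the rows: the zero combination is excluded, so a member with
    zero coefficients and nonnegative right-hand side refutes the strict system. Coefficients are
    indexed by [nat], so that eliminating an unknown does not change their type. *)
Inductive poscone (R : realFieldType) (E : finType) (P : pred E)
    (a : E -> nat -> R) (b : E -> R) : (nat -> R) -> R -> Prop :=
| poscone_gen e : P e -> poscone P a b (a e) (b e)
| poscone_add a1 b1 a2 b2 : poscone P a b a1 b1 -> poscone P a b a2 b2 ->
    poscone P a b (fun i => a1 i + a2 i) (b1 + b2)
| poscone_scale t a1 b1 : 0 < t -> poscone P a b a1 b1 ->
    poscone P a b (fun i => t * a1 i) (t * b1).

Lemma poscone_trans (R : realFieldType) (E E' : finType) (P : pred E)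
    (P' : pred E') (a : E -> nat -> R) (b : E -> R) (a' : E' -> nat -> R)
    (b' : E' -> R) :
  (forall e, P' e -> poscone P a b (a' e) (b' e)) ->
  forall a0 b0, poscone P' a' b' a0 b0 -> poscone P a b a0 b0.
Proof.
move=> sub a0 b0; elim=> [e /sub//|a1 b1 a2 b2 _ h1 _ h2|t a1 b1 t0 _ h].
  exact: poscone_add.
exact: poscone_scale.
Qed.

Lemma poscone_coord0 (R : realFieldType) (E : finType) (P : pred E)
    (a : E -> nat -> R) (b : E -> R) n :
  (forall e, P e -> a e n = 0) ->
  forall a0 b0, poscone P a b a0 b0 -> a0 n = 0.
Proof.
move=> h a0 b0; elim=> [e /h//|a1 b1 a2 b2 _ -> _ ->|t a1 b1 t0 _ ->].
  by rewrite addr0.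
by rewrite mulr0.
Qed.

Lemma exists_between (R : realFieldType) (E : finType) (P Q : pred E)
    (L U : E -> R) :
  (forall e f, P e -> Q f -> L e < U f) ->
  exists x, (forall e, P e -> L e < x) /\ (forall f, Q f -> x < U f).
Proof.
move=> LU; have [e0 Pe0|noP] := pickP P; last first.
  exists (- (\sum_f `|U f|) - 1); split=> [e|f _]; first by rewrite noP.
  have h : `|U f| <= \sum_f `|U f| by rewrite (bigD1 f)//= lerDl sumr_ge0.
  have := ler_norm (- U f); rewrite normrN; lra.
have [f0 Qf0|noQ] := pickP Q; last first.
  exists (\sum_f `|L f| + 1); split=> [e _|f]; last by rewrite noQ.
  have h : `|L e| <= \sum_f `|L f| by rewrite (bigD1 e)//= lerDl sumr_ge0.
  have := ler_norm (L e); lra.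
pose e1 := [arg max_(e > e0 | P e) L e]%O; pose f1 := [arg min_(f < f0 | Q f) U f]%O.
have [Pe1 maxL] : P e1 /\ forall e, P e -> L e <= L e1.
  by rewrite /e1; case: arg_maxP.
have [Qf1 minU] : Q f1 /\ forall f, Q f -> U f1 <= U f.
  by rewrite /f1; case: arg_minP.
have := LU _ _ Pe1 Qf1 => LU1.
exists ((L e1 + U f1) / 2); split=> [e /maxL|f /minU]; lra.
Qed.

(* Fourier-Motzkin elimination of the last unknown. *)
Lemma strict_system_alternative (R : realFieldType) n (E : finType) (P : pred E)
    (a : E -> nat -> R) (b : E -> R) :
  (exists p : nat -> R, forall e, P e -> b e < \sum_(i < n) a e i * p i) \/
  (exists a0 b0, [/\ poscone P a b a0 b0, 0 <= b0
                   & forall i, (i < n)%N -> a0 i = 0]).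
Proof.
elim: n E P a b => [|n IH] E P a b.
  have [e /andP[Pe be]|h] := pickP (fun e => P e && (0 <= b e)).
    by right; exists (a e), (b e); split=> //; apply: poscone_gen.
  left; exists (fun=> 0) => e Pe; rewrite big_ord0 ltNge.
  by have := h e; rewrite Pe/= => ->.
(* Rows free of the last unknown are kept; two rows in which it has opposite signs are combined with
   the positive weights that cancel it. *)
pose P' (u : E + E * E) := match u with
  | inl e => P e && (a e n == 0)
  | inr (e, f) => [&& P e, P f, 0 < a e n & a f n < 0] end.
pose a' (u : E + E * E) i := match u with
  | inl e => a e i | inr (e, f) => (- a f n) * a e i + a e n * a f i end.
pose b' (u : E + E * E) := match u with
  | inl e => b e | inr (e, f) => (- a f n) * b e + a e n * b f end.
have sub u : P' u -> poscone P a b (a' u) (b' u).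
  case: u => [e /andP[Pe _]|[e f] /and4P[Pe Pf ae af]].
    exact: poscone_gen.
  apply: (@poscone_add _ _ _ _ _ (fun i => - a f n * a e i) _
            (fun i => a e n * a f i)).
    by apply: poscone_scale; [rewrite oppr_gt0|apply: poscone_gen].
  by apply: poscone_scale => //; apply: poscone_gen.
have [[p hp]|[a0 [b0 [ha hb h0]]]] := IH _ P' a' b'; last first.
  right; exists a0, b0; split=> // [|i]; first exact: poscone_trans sub _ _ ha.
  rewrite ltnS leq_eqVlt => /orP[/eqP->|/h0//].
  apply: poscone_coord0 ha => -[e /andP[_ /eqP//]|[e f] _ /=]; ring.
pose s e := \sum_(i < n) a e i * p i.
(* The bound that row [e] puts on the last unknown once [p] is fixed: from below if [a e n] is
   positive, from above if it is negative. *)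
pose bound e := (b e - s e) / a e n.
have LU e f : P e && (0 < a e n) -> P f && (a f n < 0) -> bound e < bound f.
  move=> /andP[Pe ae] /andP[Pf af].
  have /hp : P' (inr (e, f)) by rewrite /= Pe Pf ae.
  rewrite /= (_ : \sum_(i < n) _ = - a f n * s e + a e n * s f); last first.
    by rewrite !mulr_sumr -big_split/=; apply: eq_bigr => i _; ring.
  move=> h; rewrite ltr_pdivrMr// mulrAC ltr_ndivlMr//; nra.
have [x [hL hU]] := exists_between LU.
left; exists (fun i => if (i < n)%N then p i else x) => e Pe.
rewrite big_ord_recr/= ltnn (eq_bigr (fun i : 'I_n => a e i * p i)); last first.
  by move=> i _; rewrite ltn_ord.
rewrite -/(s e); have [ae|ae|ae] := ltgtP (a e n) 0.
- have := hU e; rewrite Pe ae => /(_ isT); rewrite /bound ltr_ndivlMr//; lra.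
- have := hL e; rewrite Pe ae => /(_ isT); rewrite /bound ltr_pdivrMr//; lra.
- rewrite ae mul0r addr0; have /hp//= : P' (inl e) by rewrite /= Pe ae eqxx.
Qed.

Lemma exists_small_step (R : realFieldType) (E : finType) (u v : E -> R) :
  (forall e, 0 <= u e) -> (forall e, u e = 0 -> 0 <= v e) ->
  exists t, 0 < t /\ forall e, 0 <= u e + t * v e.
Proof.
move=> u0 uv.
(* A ratio test. The default [1] covers the case of no positive [u e], and the [+ 1] keeps the
   denominator positive when [v e = 0]. *)
exists (\big[Order.min/1]_(e | 0 < u e) (u e / (`|v e| + 1))); split.
  elim/big_ind : _ => // [x y x0 y0|e ue]; first by rewrite lt_min x0.
  by rewrite divr_gt0// ltr_wpDl.
move=> e; set t := \big[_/_]_(_ | _) _.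
have t0 : 0 < t.
  rewrite /t; elim/big_ind : _ => // [x y x0 y0|f uf]; first by rewrite lt_min x0.
  by rewrite divr_gt0// ltr_wpDl.
have [ue|] := ltP 0 (u e); last first.
  move=> ue; have ue0 : u e = 0 by apply/eqP; rewrite eq_le ue u0.
  by rewrite ue0 add0r mulr_ge0 ?uv// ltW.
have : t <= u e / (`|v e| + 1) by rewrite /t (bigD1 e)//= ge_min lexx.
have v1 : 0 < `|v e| + 1 by rewrite ltr_wpDl.
rewrite ler_pdivlMr// => h.
have := ler_norm (- v e); rewrite normrN => h2.
have : t * (- v e) <= t * `|v e| by rewrite ler_pM2l.
lra.
Qed.

Lemma exists_solution (R : fieldType) (V E : finType) (F : {set V})
    (G : {set E}) (a : E -> V -> R) : (#|G| < #|F|)%N ->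
  exists z : V -> R, [/\ exists v, z v != 0, forall v, v \notin F -> z v = 0
    & forall e, e \in G -> \sum_v a e v * z v = 0].
Proof.
move=> ltGF.
(* Unknowns index the rows and equations the columns, so the solutions form the left kernel, which
   is nonzero because the rank is at most [#|G|]. *)
pose A : 'M[R]_(#|F|, #|G|) := \matrix_(i, j) a (enum_val j) (enum_val i).
have [w Aw w0] : exists2 w : 'rV[R]_#|F|, w *m A = 0 & w != 0.
  have : kermx A != 0.
    rewrite -mxrank_eq0 mxrank_ker -lt0n subn_gt0.
    exact: leq_ltn_trans (rank_leq_col A) ltGF.
  by case/rowV0Pn => w /sub_kermxP ? ?; exists w.
have [i0 wi0] : exists i, w 0 i != 0.
  apply/existsP; apply: contraNT w0; rewrite negb_exists => /forallP h.
  apply/eqP/rowP => i; rewrite mxE; apply/eqP; move: (h i).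
  by rewrite negbK.
have F0 : enum_val i0 \in F by exact: enum_valP.
pose z v := if v \in F then w 0 (enum_rank_in F0 v) else 0.
exists z; split=> [|v|e eG]; first by exists (enum_val i0); rewrite /z F0 enum_valK_in.
  by rewrite /z => /negbTE ->.
rewrite (bigID (mem F))/= [X in _ + X]big1 ?addr0; last first.
  by move=> v /negbTE vF; rewrite /z vF mulr0.
move: (congr1 (fun M : 'rV_#|G| => M 0 (enum_rank_in eG e)) Aw).
rewrite !mxE => h; rewrite -[RHS]h big_enum_val/=; apply: eq_bigr => i _.
by rewrite /z enum_valP enum_valK_in mxE enum_rankK_in// mulrC.
Qed.

Lemma big_option (R : nmodType) (I : finType) (F : option I -> R) :
  \sum_r F r = F None + \sum_i F (Some i).
Proof.
rewrite (bigD1 None)//=; congr (_ + _).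
rewrite (reindex_omap Some id)/=; last by case.
by apply: eq_bigl => i; rewrite eqxx.
Qed.

Lemma sum_indicator (R : pzRingType) (I : finType) (a : I) (F : I -> R) :
  \sum_j F j * (j == a)%:R = F a.
Proof.
rewrite (bigD1 a)//= eqxx mulr1 big1 ?addr0// => j /negbTE->.
by rewrite mulr0.
Qed.

(** * The assignment LP with a unique optimum: integrality and strict complementarity *)

Section AssignmentLP.
Context (R : realType) (k d : nat) (m x : 'I_k -> 'cV[R]_d).
Hypothesis xopt : lp_optimal m x.
Hypothesis xuniq : forall y, lp_optimal m y -> x = y.

Let xge0 i j : 0 <= x i j 0. Proof. by case: xopt => -[]. Qed.
Let xsum1 i : \sum_j x i j 0 = 1. Proof. by case: xopt => -[]. Qed.
Let xcol j : \sum_i x i j 0 <= 1.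
Proof. by case: xopt => -[_ _ /(_ j)]; rewrite summxE. Qed.

(** A short step from [x] along [z] stays feasible and does not lower the objective, so it ends at
    an optimum, which by uniqueness is [x] itself. *)
Lemma lp_direction_eq0 (z : 'I_k -> 'I_d -> R) :
  (forall i, \sum_j z i j = 0) ->
  (forall i j, x i j 0 = 0 -> 0 <= z i j) ->
  (forall j, \sum_i x i j 0 = 1 -> \sum_i z i j <= 0) ->
  0 <= \sum_i \sum_j m i j 0 * z i j ->
  forall i j, z i j = 0.
Proof.
move=> zrow zsgn zcol zobj.
(* [u] lists the slacks of the inequality constraints at [x], and [v] their rates of change along
   [z]. *)
pose u (e : 'I_k * 'I_d + 'I_d) := match e with
  | inl (i, j) => x i j 0 | inr j => 1 - \sum_i x i j 0 end.
pose v (e : 'I_k * 'I_d + 'I_d) := match e with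
  | inl (i, j) => z i j | inr j => - \sum_i z i j end.
have [t [t0 ht]] : exists t, 0 < t /\ forall e, 0 <= u e + t * v e.
  apply: exists_small_step => -[[i j]|j] //=.
  - by rewrite subr_ge0.
  - exact: zsgn.
  - by move=> /eqP; rewrite subr_eq0 eq_sym oppr_ge0 => /eqP; exact: zcol.
pose y i : 'cV[R]_d := \col_j (x i j 0 + t * z i j).
have yx : x = y.
  apply: xuniq; split.
    split=> [i j|i|j]; first by rewrite mxE; exact: (ht (inl (i, j))).
      under eq_bigr do rewrite mxE.
      by rewrite big_split/= -mulr_sumr zrow mulr0 addr0.
    rewrite summxE; under eq_bigr do rewrite mxE.
    rewrite big_split/= -mulr_sumr; have := ht (inr j) => /=; lra.
  move=> w /(proj2 xopt) /le_trans; apply.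
  rewrite /lp_obj -subr_ge0 -sumrB.
  suff -> : \sum_i (((m i)^T *m y i) 0 0 - ((m i)^T *m x i) 0 0) =
            t * \sum_i \sum_j m i j 0 * z i j by rewrite mulr_ge0// ltW.
  rewrite mulr_sumr; apply: eq_bigr => i _; rewrite !mxE -sumrB mulr_sumr.
  by apply: eq_bigr => j _; rewrite !mxE; ring.
move=> i j; move: (congr1 (fun f : 'I_k -> 'cV[R]_d => f i j 0) yx).
rewrite mxE => h; have /eqP : t * z i j = 0 by lra.
by rewrite mulf_eq0 gt_eqF//= => /eqP.
Qed.

(* Add a slack row [None], so that all column sums are 1 and all row sums are
   integers.  Every row and column meeting the set [F] of fractional cells then
   contains at least two of them, so [F] has at least as many cells as it meets
   rows and columns together.  As one column equation is redundant, some nonzero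
   [z] supported on [F] has zero row and column sums, and [x] can be moved along
   [z] or [- z] without loss. *)
Lemma lp_opt_integral i j : x i j 0 = 0 \/ x i j 0 = 1.
Proof.
pose X (r : option 'I_k) c := if r is Some i then x i c 0 else 1 - \sum_i x i c 0.
have X0 r c : 0 <= X r c by case: r => [r|] /=; rewrite ?subr_ge0.
have Xcol c : \sum_r X r c = 1.
  by rewrite big_option/= subrK.
have Xrow r : \sum_c X r c \is a Num.int.
  case: r => [r|] /=; first by rewrite xsum1.
  rewrite sumrB rpredB//; first by apply: rpred_sum => c _; rewrite int_num1.
  by rewrite exchange_big/=; apply: rpred_sum => c _; rewrite xsum1 int_num1.
have X1 r c : X r c <= 1.
  by rewrite -(Xcol c) (bigD1 r)//= lerDl sumr_ge0.
have Xint r c : X r c \is a Num.int -> ~~ (0 < X r c < 1).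
  by move=> /intrP[n ->]; rewrite ltr0z ltrz1; lia.
pose F := [set e : option 'I_k * 'I_d | 0 < X e.1 e.2 < 1].
have FP r c : ((r, c) \in F) = (0 < X r c < 1) by rewrite inE.
clearbody F.
have notF r c : (r, c) \notin F -> X r c \is a Num.int.
  rewrite FP; have := X0 r c; have := X1 r c.
  rewrite !le_eqVlt => /orP[/eqP->|->] // /orP[/eqP<-|->] //.
have [[r0 c0] rcF|F0] := pickP (mem F); last first.
  have := negbT (F0 (Some i, j)); rewrite /= FP/= => xij.
  have := X0 (Some i) j; have := X1 (Some i) j; rewrite /= !le_eqVlt.
  case/orP => [/eqP->|lt1]; first by right.
  by case/orP => [/eqP<-|lt0]; [left|move: xij; rewrite lt0 lt1].
exfalso.
pose RF := [set r | [exists c, (r, c) \in F]].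
pose CF := [set c | [exists r, (r, c) \in F]].
(* If a row had a single fractional entry, that entry would be an integer sum minus integers, hence
   an integer. Columns are treated alike below. *)
have rowF r : r \in RF -> (1 < #|[set c | (r, c) \in F]|)%N.
  rewrite inE => /existsP[c rcf].
  rewrite ltnNge; apply/negP => le1.
  suff /Xint/negP : X r c \is a Num.int by apply; rewrite -FP.
  have := Xrow r; rewrite (bigD1 c)//= => h.
  rewrite -[X r c](addrK (\sum_(i < d | i != c) X r i)) rpredB// rpred_sum// => c' cc'.
  apply: notF; apply: contra cc' => rc'f.
  have := card_le1P le1 c; rewrite inE => /(_ rcf c').
  by rewrite !inE rc'f => /esym/eqP->.
have colF c : c \in CF -> (1 < #|[set r | (r, c) \in F]|)%N.
  rewrite inE => /existsP[r rcf].
  rewrite ltnNge; apply/negP => le1.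
  suff /Xint/negP : X r c \is a Num.int by apply; rewrite -FP.
  have := Xcol c; rewrite (bigD1 r)//= => h.
  rewrite -[X r c](addrK (\sum_(i | i != r) X i c)) h.
  rewrite rpredB ?int_num1// rpred_sum// => r' rr'.
  apply: notF; apply: contra rr' => rc'f.
  have := card_le1P le1 r; rewrite inE => /(_ rcf r').
  by rewrite !inE rc'f => /esym/eqP->.
have cardR : #|F| = (\sum_(r in RF) #|[set c | (r, c) \in F]|)%N.
  rewrite -sum1_card (partition_big fst (mem RF))/=; last first.
    by case=> r c rcf; rewrite inE; apply/existsP; exists c.
  apply: eq_bigr => r _; rewrite -sum1_card.
  rewrite (reindex_omap (fun c => (r, c)) (fun v => Some v.2))/=; last first.
    by case=> r' c /andP[_ /eqP<-].
  by apply: eq_bigl => c; rewrite inE/= !eqxx !andbT.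
have cardC : #|F| = (\sum_(c in CF) #|[set r | (r, c) \in F]|)%N.
  rewrite -sum1_card (partition_big snd (mem CF))/=; last first.
    by case=> r c rcf; rewrite inE; apply/existsP; exists r.
  apply: eq_bigr => c _; rewrite -sum1_card.
  rewrite (reindex_omap (fun r => (r, c)) (fun v => Some v.1))/=; last first.
    by case=> r c' /andP[_ /eqP<-].
  by apply: eq_bigl => r; rewrite inE/= !eqxx !andbT.
have c0C : c0 \in CF by rewrite inE; apply/existsP; exists r0.
(* Two cells in each row and column of [F] give [#|RF| + #|CF| <= #|F|]; leaving out the equation of
   [c0], which follows from the others, makes the count strict. *)
pose G : {set option 'I_k + 'I_d} :=
  [set e | match e with inl r => r \in RF | inr c => (c != c0) && (c \in CF) end].
have ltGF : (#|G| < #|F|)%N.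
  have -> : #|G| = (#|RF| + (#|CF|).-1)%N.
    rewrite (cardsD1 c0 CF) c0C add1n/= -!sum1_card big_sumType/=.
    by congr (_ + _)%N; apply: eq_bigl => e; rewrite !inE.
  have h1 : (#|RF| * 2 <= #|F|)%N.
    by rewrite cardR -sum_nat_const; apply: leq_sum.
  have h2 : (#|CF| * 2 <= #|F|)%N.
    by rewrite cardC -sum_nat_const; apply: leq_sum.
  have : (0 < #|CF|)%N by apply/card_gt0P; exists c0.
  lia.
pose a (e : option 'I_k + 'I_d) (v : option 'I_k * 'I_d) : R :=
  match e with inl r => (v.1 == r)%:R | inr c => (v.2 == c)%:R end.
have [z [[[r1 c1] z1] z2 z3]] := exists_solution a ltGF.
have sumr r : \sum_v a (inl r) v * z v = \sum_c z (r, c).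
  transitivity (\sum_r' \sum_c (r' == r)%:R * z (r', c)).
    by rewrite pair_bigA; apply: eq_bigr => -[].
  rewrite (bigD1 r)//= [X in _ + X]big1 ?addr0 => [|r' /negbTE->].
    by apply: eq_bigr => c _; rewrite eqxx mul1r.
  by rewrite big1// => c _; rewrite mul0r.
have sumc c : \sum_v a (inr c) v * z v = \sum_r z (r, c).
  transitivity (\sum_r \sum_c' (c' == c)%:R * z (r, c')).
    by rewrite pair_bigA; apply: eq_bigr => -[].
  apply: eq_bigr => r _; rewrite (bigD1 c)//= [X in _ + X]big1 ?addr0.
    by rewrite eqxx mul1r.
  by move=> c' /negbTE->; rewrite mul0r.
have zrow r : \sum_c z (r, c) = 0.
  have [rR|rR] := boolP (r \in RF).
    by rewrite -sumr z3// inE.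
  apply: big1 => c _; apply: z2; apply: contra rR => rcf.
  by rewrite inE; apply/existsP; exists c.
have zcol' c : c != c0 -> \sum_r z (r, c) = 0.
  move=> cc0; have [cC|cC] := boolP (c \in CF).
    by rewrite -sumc z3// inE cc0.
  apply: big1 => r _; apply: z2; apply: contra cC => rcf.
  by rewrite inE; apply/existsP; exists r.
have zcol c : \sum_r z (r, c) = 0.
  have [->|/zcol'//] := eqVneq c c0.
  have : \sum_c \sum_r z (r, c) = 0 by rewrite exchange_big big1.
  by rewrite (bigD1 c0)//= [X in _ + X]big1 ?addr0.
have zN c : z (None, c) = - \sum_i z (Some i, c).
  by apply/eqP; rewrite -addr_eq0; have := zcol c; rewrite big_option => ->.
(* To be used with [s = 1] or [s = -1], whichever does not lower the objective. A tight column has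
   slack entry zero, hence outside [F], so [z] preserves its sum. *)
have dir (s : R) : 0 <= \sum_i \sum_j m i j 0 * (s * z (Some i, j)) ->
    forall i j, s * z (Some i, j) = 0.
  apply: lp_direction_eq0 => [i'|i' j' xz|j' xz].
  - by rewrite -mulr_sumr zrow mulr0.
  - rewrite z2 ?mulr0// FP /= xz ltxx//.
  - have : z (None, j') = 0 by apply: z2; rewrite FP/= xz subrr ltxx.
    by rewrite zN => /eqP; rewrite oppr_eq0 -mulr_sumr => /eqP->; rewrite mulr0.
have zS i' j' : z (Some i', j') = 0.
  have [h|h] := leP 0 (\sum_i \sum_j m i j 0 * z (Some i, j)).
    rewrite -[LHS]mul1r; apply: dir.
    by under eq_bigr do under eq_bigr do rewrite mul1r.
  apply: oppr_inj; rewrite oppr0 -mulN1r; apply: dir.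
  under eq_bigr do under eq_bigr do rewrite mulN1r mulrN.
  by under eq_bigr do rewrite sumrN; rewrite sumrN oppr_ge0 ltW.
move/eqP: z1; apply; case: r1 => [r1|]; first exact: zS.
by rewrite zN big1 ?oppr0.
Qed.

(** [sigma] is read off the integral [x]. If the strict system for [y] had no solution, the
    alternative would yield a direction [z] and weights [s], not both zero, contradicting
    [lp_direction_eq0]. *)
Lemma lp_strict_dual : exists (sigma : 'I_k -> 'I_d) (y : 'I_d -> R),
  [/\ injective sigma, forall i, 0 < y (sigma i),
      forall j, (forall i, sigma i != j) -> y j = 0
    & forall i j, j != sigma i -> m i j 0 - m i (sigma i) 0 < y j - y (sigma i)].
Proof.
have /choice[sigma xsigma] : forall i, exists j, x i j 0 = 1.
  move=> i; apply: contrapT => /forallNP h.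
  have := xsum1 i; rewrite big1 => [/eqP|j _]; first by rewrite eq_sym oner_eq0.
  by have [//|/h] := lp_opt_integral i j.
have x0 i j : j != sigma i -> x i j 0 = 0.
  move=> ji; have := xsum1 i; rewrite (bigD1 (sigma i))//= xsigma (bigD1 j)//=.
  have : 0 <= \sum_(l < d | (l != sigma i) && (l != j)) x i l 0.
    by apply: sumr_ge0 => l _.
  have := xge0 i j; lra.
have sigma_inj : injective sigma.
  move=> i l eq_il; apply/eqP; apply: contraT => neq_il.
  have := xcol (sigma i); rewrite (bigD1 i)//= xsigma (bigD1 l)/=; last by rewrite eq_sym.
  rewrite {1}eq_il xsigma.
  have : 0 <= \sum_(i0 < k | (i0 != i) && (i0 != l)) x i0 (sigma i) 0.
    by apply: sumr_ge0.
  lra.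
exists sigma.
pose im (j : 'I_d) := [exists i, sigma i == j].
have imsigma i : im (sigma i) by apply/existsP; exists i.
(* Rows [inl (i, j)] encode the slack inequalities and rows [inr j] the positivity of [y] on the
   image of [sigma]; the factor [im j] in [a] sets [y j] to zero off the image. *)
pose P (e : 'I_k * 'I_d + 'I_d) := match e with
  | inl (i, j) => j != sigma i | inr j => im j end.
pose a (e : 'I_k * 'I_d + 'I_d) (c : nat) : R := match e with
  | inl (i, j) => (im j && (c == j))%:R - (c == sigma i)%:R
  | inr j => (c == j)%:R end.
pose b (e : 'I_k * 'I_d + 'I_d) := match e with
  | inl (i, j) => m i j 0 - m i (sigma i) 0 | inr j => 0 end.
have [[p hp]|[a0 [b0 [hab b0_ge0 a00]]]] := strict_system_alternative d P a b.
  have sump (j : 'I_d) (B : bool) : \sum_(c < d) (B && (c == j :> nat))%:R * p c = B%:R * p j.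
    rewrite (bigD1 j)//= eqxx andbT [X in _ + X]big1 ?addr0// => c /negbTE cj.
    by rewrite -val_eqE/= in cj; rewrite cj andbF mul0r.
  exists (fun j => (im j)%:R * p j); split=> // [i|j jsigma|i j ji].
  - have := hp (inr (sigma i)) (imsigma i); rewrite /= (sump _ true).
    by rewrite imsigma.
  - rewrite (_ : im j = false) ?mul0r//; apply/negbTE/existsP => -[i].
    by rewrite (negbTE (jsigma i)).
  - have /= := hp (inl (i, j)) ji.
    under eq_bigr do rewrite mulrBl.
    by rewrite sumrB sump (sump _ true) imsigma.
exfalso.
(* A certificate of infeasibility is a direction [z] for the primal LP, with
   [s] the weights of the constraints [0 < y (sigma i)]. *)
have [z [s [[zrow zge0 sge0 za] zb nz]]] : exists z s,
    [/\ [/\ forall i, \sum_j z i j = 0, forall i j, j != sigma i -> 0 <= z i j,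
         forall j, 0 <= s j & forall j : 'I_d, im j -> a0 j = \sum_i z i j + s j],
      b0 = \sum_i \sum_j m i j 0 * z i j
    & (exists i j, j != sigma i /\ 0 < z i j) \/ (exists2 j : 'I_d, im j & 0 < s j)].
  elim: hab {b0_ge0 a00} => {a0 b0} [e Pe|a1 b1 a2 b2 _ h1 _ h2|t a1 b1 t0 _ h].
  - case: e Pe => [[i j] /= ji|j imj].
      exists (fun i' j' => if i' == i then (j' == j)%:R - (j' == sigma i)%:R else 0),
        (fun=> 0); split.
      + split=> // [i'|i' j' ji'|j' imj'].
        * case: eqP => _; last by rewrite big1.
          rewrite sumrB; under eq_bigr do rewrite -[_%:R]mul1r.
          under [X in _ - X]eq_bigr do rewrite -[_%:R]mul1r.
          by rewrite !sum_indicator subrr.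
        * have [ii|//] := eqVneq i' i; move: ji'; rewrite ii => /negbTE->.
          by rewrite subr0 ler0n.
        * rewrite addr0 [RHS](bigD1 i)//= eqxx [X in _ = _ + X]big1; last first.
            by move=> i' /negbTE->.
          rewrite addr0 !val_eqE; have [<-|_] := eqVneq j' j; last by rewrite andbF.
          by rewrite imj'.
      + rewrite [RHS](bigD1 i)//= eqxx [X in _ = _ + X]big1 ?addr0; last first.
          by move=> i' /negbTE->; rewrite big1// => j' _; rewrite mulr0.
        under eq_bigr do rewrite mulrBr.
        by rewrite sumrB !sum_indicator.
      + left; exists i, j; split=> //; rewrite !eqxx (negbTE ji) subr0; exact: ltr01.
    exists (fun _ _ => 0), (fun j' => (j' == j)%:R); split.
    + split=> // [i|j' imj']; first by rewrite big1.
      by rewrite big1// add0r.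
    + by rewrite big1// => i _; rewrite big1// => j' _; rewrite mulr0.
    + by right; exists j; rewrite // eqxx ltr01.
  - case: h1 => [z1 [s1 [[zr1 zg1 sg1 za1] zb1 nz1]]].
    case: h2 => [z2 [s2 [[zr2 zg2 sg2 za2] zb2 nz2]]].
    exists (fun i j => z1 i j + z2 i j), (fun j => s1 j + s2 j); split.
    + split=> [i|i j ji|j|j imj].
      * by rewrite big_split/= zr1 zr2 addr0.
      * by rewrite addr_ge0 ?zg1 ?zg2.
      * by rewrite addr_ge0.
      * by rewrite za1// za2// big_split/=; ring.
    + rewrite zb1 zb2 -big_split/=; apply: eq_bigr => i _.
      by rewrite -big_split/=; apply: eq_bigr => j _; rewrite mulrDr.
    + case: nz1 => [[i [j [ji zij]]]|[j imj sj]]; [left; exists i, j|right; exists j] => //.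
        by rewrite ltr_wpDr ?zg2.
      by rewrite ltr_wpDr.
  - case: h => [z1 [s1 [[zr1 zg1 sg1 za1] zb1 nz1]]].
    exists (fun i j => t * z1 i j), (fun j => t * s1 j); split.
    + split=> [i|i j ji|j|j imj].
      * by rewrite -mulr_sumr zr1 mulr0.
      * by rewrite mulr_ge0 ?zg1 ?ltW.
      * by apply: mulr_ge0 => //; exact: ltW.
      * by rewrite za1// -mulr_sumr mulrDr.
    + rewrite zb1 mulr_sumr; apply: eq_bigr => i _.
      by rewrite mulr_sumr; apply: eq_bigr => j _; ring.
    + case: nz1 => [[i [j [ji zij]]]|[j imj sj]]; [left; exists i, j|right; exists j] => //.
        by rewrite mulr_gt0.
      by rewrite mulr_gt0.
(* A tight column [j] lies in the image of [sigma], where the certificate gives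
   [\sum_i z i j = - s j <= 0]; so [z] is an admissible direction and vanishes, and then [s]
   vanishes on the image too. *)
have z0 : forall i j, z i j = 0.
  apply: lp_direction_eq0 => //; last by rewrite -zb.
    move=> i j xij; apply: zge0; apply/eqP => ji; move: xij.
    by rewrite ji xsigma => /eqP; rewrite oner_eq0.
  move=> j xj; have imj : im j.
    apply: contraT; rewrite negb_exists => /forallP h.
    move: xj; rewrite big1 => [/eqP|i _]; first by rewrite eq_sym oner_eq0.
    by apply: x0; rewrite eq_sym h.
  have := za j imj; rewrite a00//; have := sge0 j; lra.
case: nz => [[i [j [_]]]|[j imj]]; first by rewrite z0 ltxx.
have := za j imj; rewrite a00// big1 ?add0r// => <-; by rewrite ltxx.
Qed.
End AssignmentLP.

(** * Positive semidefinite matrices *)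

Lemma psdmx_congr (R : realType) (d e : nat) (X : 'M[R]_d) (B : 'M[R]_(d, e)) :
  psdmx X -> psdmx (B^T *m X *m B).
Proof.
move=> [XT X0]; split; first by rewrite !trmx_mul trmxK XT mulmxA.
by move=> v; have := X0 (B *m v); rewrite trmx_mul !mulmxA.
Qed.

Lemma psdmx_gram (R : realType) (d e : nat) (B : 'M[R]_(d, e)) :
  psdmx (B *m B^T).
Proof.
split; first by rewrite trmx_mul trmxK.
move=> v; have -> : v^T *m (B *m B^T) *m v = (B^T *m v)^T *m (B^T *m v).
  by rewrite trmx_mul trmxK !mulmxA.
by rewrite mxE; apply: sumr_ge0 => i _; rewrite mxE -expr2 sqr_ge0.
Qed.

Lemma form_add (R : comPzRingType) (d : nat) (X : 'M[R]_d) (v w : 'cV[R]_d) t :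
  X^T = X ->
  ((v + t *: w)^T *m X *m (v + t *: w)) 0 0 =
  (v^T *m X *m v) 0 0 + 2%:R * t * (w^T *m X *m v) 0 0
  + t ^+ 2 * (w^T *m X *m w) 0 0.
Proof.
move=> XT; have -> : (v + t *: w)^T *m X *m (v + t *: w) =
    v^T *m X *m v + t *: (w^T *m X *m v) + t *: (v^T *m X *m w)
    + t *: (t *: (w^T *m X *m w)).
  rewrite [(v + _)^T]linearD/= [(t *: w)^T]linearZ/= !(mulmxDl, mulmxDr).
  by rewrite -!scalemxAl -!scalemxAr !addrA.
have -> : v^T *m X *m w = (w^T *m X *m v)^T by rewrite !trmx_mul trmxK XT mulmxA.
move: (v^T *m _ *m _) (w^T *m _ *m v) (w^T *m _ *m w) => A B C.
by rewrite !mxE; ring.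
Qed.

Lemma delta_form (R : realType) (d : nat) (X : 'M[R]_d) (a b : 'I_d) :
  ((delta_mx a 0 : 'cV_d)^T *m X *m delta_mx b (0 : 'I_1)) 0 0 = X a b.
Proof. by rewrite trmx_delta -rowE -colE !mxE. Qed.

Lemma psdmx_diag_ge0 (R : realType) (d : nat) (X : 'M[R]_d) a :
  psdmx X -> 0 <= X a a.
Proof. by move=> [_ /(_ (delta_mx a 0))]; rewrite delta_form. Qed.

Lemma psdmx_tr_ge0 (R : realType) (d : nat) (X : 'M[R]_d) :
  psdmx X -> 0 <= \tr X.
Proof. by move=> X0; apply: sumr_ge0 => a _; exact: psdmx_diag_ge0. Qed.

(** The form is nonnegative at the sum and at the difference of the two basis vectors. *)
Lemma psdmx_normr_le (R : realType) (d : nat) (X : 'M[R]_d) a b :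
  psdmx X -> `|X a b| <= (X a a + X b b) / 2.
Proof.
move=> [XT X0]; have Xba : X b a = X a b by rewrite -{1}XT mxE.
have key (s : R) : s * s = 1 -> 0 <= X a a + 2 * s * X a b + X b b.
  move=> ss; have := X0 (delta_mx a 0 + s *: delta_mx b 0).
  by rewrite form_add// !delta_form Xba expr2 ss mul1r.
have := key 1 (mulr1 _); have := key (-1); rewrite mulrNN => /(_ (mulr1 _)).
by rewrite ler_norml => h1 h2; apply/andP; split; lra.
Qed.

Lemma psdmx_tr0 (R : realType) (d : nat) (X : 'M[R]_d) :
  psdmx X -> \tr X = 0 -> X = 0.
Proof.
move=> X0 /eqP; rewrite psumr_eq0 => [|a _]; last exact: psdmx_diag_ge0.
move=> /allP h; have Xaa a : X a a = 0.
  by apply/eqP; apply: h; rewrite mem_index_enum.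
apply/matrixP => a b; rewrite mxE; apply/eqP; rewrite -normr_le0.
by have := psdmx_normr_le a b X0; rewrite !Xaa addr0 mul0r.
Qed.

Lemma psdmx_form0 (R : realType) (d : nat) (X : 'M[R]_d) (v : 'cV[R]_d) :
  psdmx X -> (v^T *m X *m v) 0 0 = 0 -> X *m v = 0.
Proof.
move=> [XT X0] v0.
have key (w : 'cV[R]_d) : (w^T *m X *m v) 0 0 = 0.
  set p : R := (_ *m v) 0 0; set q : R := (w^T *m X *m w) 0 0.
  have q0 : 0 <= q by exact: X0.
  have h t : 0 <= 2 * t * p + t ^+ 2 * q.
    by have := X0 (v + t *: w); rewrite form_add// v0 add0r.
  (* Close to the minimiser [- p / q] of the quadratic, with a denominator that stays positive when
     [q = 0]; the value is negative unless [p = 0]. *)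
  have := h (- p / (q + 1)); clear -q0.
  rewrite (_ : _ + _ = - (p ^+ 2 * ((q + 2) / (q + 1) ^+ 2))); last by field; lra.
  rewrite oppr_ge0 pmulr_lle0 ?divr_gt0 ?exprn_gt0//; [|lra|lra].
  by move=> p2; apply/eqP; rewrite -sqrf_eq0 eq_le p2 sqr_ge0.
apply/matrixP => a j; rewrite ord1 [RHS]mxE.
have := key (delta_mx a 0); rewrite trmx_delta -mulmxA -rowE.
by rewrite mxE.
Qed.

(** The diagonal part contributes at least [c * \tr X]. An entrywise error [tau] costs at most
    [tau * (X a a + X b b) / 2] per entry, which sums to [d * tau * \tr X]. *)
Lemma mxtrace_mul_near_diag (R : realType) (d : nat) (A X : 'M[R]_d)
    (D : 'I_d -> R) (c tau : R) :
  (forall a b, `|A a b - (D a) *+ (a == b)| <= tau) -> (forall a, c <= D a) ->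
  psdmx X -> (c - d%:R * tau) * \tr X <= \tr (A *m X).
Proof.
move=> hA hD X0.
have hterm a b : c * X a a *+ (a == b) - tau * ((X a a + X b b) / 2) <= A a b * X b a.
  have := hA a b; rewrite ler_norml => /andP[h1 h2].
  have := psdmx_normr_le b a X0; rewrite ler_norml => /andP[h3 h4].
  case: eqVneq h1 h2 => [<-|ab]; rewrite ?mulr1n ?mulr0n => h1 h2.
    by have := psdmx_diag_ge0 a X0; have := hD a; nra.
  nra.
have -> : (c - d%:R * tau) * \tr X = \sum_a \sum_b
    (c * X a a *+ (a == b) - tau * ((X a a + X b b) / 2)).
  under eq_bigr do rewrite sumrB -mulr_sumr -mulr_suml big_split/=.
  rewrite sumrB -mulr_sumr -mulr_suml big_split/=.
  under eq_bigr => a _.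
    rewrite (bigD1 a)//= eqxx [X in _ + X]big1 ?addr0; last first.
      by move=> b; rewrite eq_sym => /negbTE->.
    over.
  rewrite -mulr_sumr.
  under [X in (X + _) / 2]eq_bigr do rewrite sumr_const card_ord.
  rewrite sumrMnl sumr_const card_ord -/(\tr X) -mulr_natl; lra.
rewrite /mxtrace; apply: ler_sum => a _; rewrite mxE; apply: ler_sum => b _.
exact: hterm.
Qed.

(** * Dual certificates from orthonormal frames *)

Lemma mxtraceB (R : pzRingType) (n : nat) (A B : 'M[R]_n) :
  \tr (A - B) = \tr A - \tr B.
Proof. exact: raddfB. Qed.

Definition colproj (R : pzRingType) (d k : nat) (U : 'M[R]_(d, k)) (i : 'I_k) :=
  col i U *m (col i U)^T.

(** The multiplier of the constraint that [\sum_i X i] is below the identity. The [i]-th term is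
    built to have trace [r i], a free parameter. *)
Definition dualY (R : pzRingType) (d k : nat) (N : 'I_k -> 'M[R]_d)
    (P : 'I_k -> 'M[R]_d) (r : 'I_k -> R) : 'M[R]_d :=
  \sum_i ((1%:M - P i) *m N i *m P i + r i *: P i).

(** The multiplier of the constraint that [X i] is semidefinite; the scalar [\tr (P i *m N i) - r i]
    is the multiplier of [\tr (X i) = 1]. *)
Definition dualS (R : pzRingType) (d k : nat) (N : 'I_k -> 'M[R]_d)
    (P : 'I_k -> 'M[R]_d) (r : 'I_k -> R) (i : 'I_k) : 'M[R]_d :=
  dualY N P r + (\tr (P i *m N i) - r i)%:M - N i.

Section OrthonormalFrame.
Context (R : realType) (d k : nat) (U : 'M[R]_(d, k)).
Hypothesis UU : U^T *m U = 1%:M.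

Lemma col_orthonormal i j : (col i U)^T *m col j U = (i == j)%:R%:M.
Proof.
apply/matrixP => a b; rewrite !ord1 !mxE eqxx mulr1n.
have := congr1 (fun A : 'M[R]_k => A i j) UU; rewrite !mxE => <-.
by apply: eq_bigr => l _; rewrite !mxE.
Qed.

Lemma trmx_colproj i : (colproj U i)^T = colproj U i.
Proof. by rewrite /colproj trmx_mul trmxK. Qed.

Lemma colprojM i j : colproj U i *m colproj U j = (i == j)%:R *: colproj U i.
Proof.
rewrite /colproj mulmxA -[X in X *m _]mulmxA col_orthonormal.
by rewrite mul_mx_scalar -scalemxAl; case: eqVneq => [->//|_]; rewrite !scale0r.
Qed.

Lemma mxtrace_colproj i : \tr (colproj U i) = 1.
Proof.
by rewrite /colproj mxtrace_mulC col_orthonormal eqxx mxtrace_scalar mulr1n.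
Qed.

Lemma colproj_sandwich i (N : 'M[R]_d) :
  colproj U i *m N *m colproj U i = \tr (colproj U i *m N) *: colproj U i.
Proof.
rewrite /colproj -[in RHS]mulmxA mxtrace_mulC.
set u := col i U.
have -> : u *m u^T *m N *m (u *m u^T) = u *m (u^T *m N *m u) *m u^T.
  by rewrite !mulmxA.
rewrite [u^T *m N *m u]mx11_scalar mxtrace_scalar mulr1n.
by rewrite mul_mx_scalar -scalemxAl.
Qed.

Lemma sum_colproj : \sum_i colproj U i = U *m U^T.
Proof.
apply/matrixP => a b; rewrite summxE mxE; apply: eq_bigr => i _.
by rewrite /colproj mxE big_ord1 !mxE.
Qed.

Lemma psdmx_colproj i : psdmx (colproj U i).
Proof. exact: psdmx_gram. Qed.

Lemma sdp_feasible_colproj : sdp_feasible (colproj U).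
Proof.
split=> [|i|i]; [|exact: mxtrace_colproj|exact: psdmx_colproj].
rewrite /lemx sum_colproj.
have -> : 1%:M - U *m U^T = (1%:M - U *m U^T) *m (1%:M - U *m U^T)^T.
  rewrite linearB/= trmx1 trmx_mul trmxK mulmxBr mulmx1 mulmxBl mul1mx.
  by rewrite mulmxA -[U *m U^T *m U]mulmxA UU mulmx1 subrr subr0.
exact: psdmx_gram.
Qed.

Section Certificate.
Variables (N : 'I_k -> 'M[R]_d) (r : 'I_k -> R).
Let P := colproj U.
Let Y := dualY N P r.
Let S := dualS N P r.

Lemma dualY_colproj i :
  Y *m P i = (1%:M - P i) *m N i *m P i + r i *: P i.
Proof.
rewrite /Y /dualY mulmx_suml (bigD1 i)//= [X in _ + X]big1 ?addr0.
  by rewrite mulmxDl -mulmxA -scalemxAl colprojM eqxx scale1r.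
move=> j ji; rewrite mulmxDl -mulmxA -scalemxAl colprojM (negbTE ji).
by rewrite scale0r mulmx0 scaler0 addr0.
Qed.

Lemma dualS_colproj i : S i *m P i = 0.
Proof.
rewrite /S /dualS mulmxBl mulmxDl dualY_colproj mulmxBl mul1mx mulmxBl.
rewrite colproj_sandwich mul_scalar_mx scalerBl.
rewrite -/P; set A := N i *m P i; set B := _ *: P i; set C := _ *: P i.
by move: A B C => A B C; apply/matrixP => a b; rewrite !mxE; ring.
Qed.

Lemma dualY_sum : Y *m (U *m U^T) = Y.
Proof.
rewrite -sum_colproj mulmx_sumr; under eq_bigr do rewrite dualY_colproj.
by [].
Qed.

Lemma mxtrace_dualY : \tr Y = \sum_i r i.
Proof.
rewrite /Y /dualY raddf_sum/=; apply: eq_bigr => i _.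
rewrite mxtraceD mxtraceZ mxtrace_colproj mulr1 mxtrace_mulC mulmxA.
by rewrite mulmxBr mulmx1 colprojM eqxx scale1r subrr mul0mx mxtrace0 add0r.
Qed.

(** Weak duality as an identity: the terms [Y *m X i] cancel, the unit traces turn the scalar shifts
    of [S i] into constants, and [\tr Y = \sum_i r i]. *)
Lemma sdp_duality_gap X : (forall i, \tr (X i) = 1) ->
  sdp_obj N P - sdp_obj N X =
  \tr (Y *m (1%:M - \sum_i X i)) + \sum_i \tr (S i *m X i).
Proof.
move=> trX; rewrite /sdp_obj mulmxBr mulmx1 mxtraceB mxtrace_dualY.
have trE (F : 'I_k -> 'M[R]_d) : \tr (\sum_i F i) = \sum_i \tr (F i) by exact: raddf_sum.
rewrite mulmx_sumr !trE -!sumrB -big_split/=; apply: eq_bigr => i _.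
rewrite /S /dualS mulmxBl mulmxDl mxtraceB mxtraceD mul_scalar_mx mxtraceZ trX.
by rewrite [\tr (N i *m P i)]mxtrace_mulC; ring.
Qed.

Hypothesis NT : forall i, (N i)^T = N i.
Hypothesis NPT : (\sum_i N i *m P i)^T = \sum_i N i *m P i.

(** By [colproj_sandwich], [Y] differs from the symmetric matrix [\sum_i N i *m P i] by a
    combination of the projections. *)
Lemma trmx_dualY : Y^T = Y.
Proof.
have -> : Y = \sum_i N i *m P i - \sum_i (\tr (P i *m N i) *: P i - r i *: P i).
  rewrite -sumrB; apply: eq_bigr => i _.
  by rewrite mulmxBl mul1mx mulmxBl colproj_sandwich opprB addrA addrAC.
rewrite linearB/= NPT; congr (_ - _).
rewrite linear_sum/=; apply: eq_bigr => i _.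
by rewrite linearB/= !linearZ/= trmx_colproj.
Qed.

Lemma trmx_dualS i : (S i)^T = S i.
Proof. by rewrite /S /dualS linearB linearD/= -/Y trmx_dualY tr_scalar_mx NT. Qed.

(** [Y] and [S i] are singular, so the hypotheses add the projections onto their expected kernels:
    this turns semidefiniteness into a strict bound, which survives perturbation. Compressing by the
    complementary projections removes the added terms again. *)
Lemma sdp_rank_one_of_certificate (c : R) : 0 < c ->
  (forall X, psdmx X -> c * \tr X <= \tr ((Y + (1%:M - \sum_i P i)) *m X)) ->
  (forall i X, psdmx X -> c * \tr X <= \tr ((S i + P i) *m X)) ->
  sdp_rank_one_property N.
Proof.
move=> c0 hY hS X [[X1 Xtr X0] Xopt] i.
have Pfeas := sdp_feasible_colproj.
have := Xopt _ Pfeas; rewrite -subr_le0 sdp_duality_gap// => gap.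
have Ypart : 0 <= \tr (Y *m (1%:M - \sum_i X i)).
  have [Pi [PiE PiT PiPi YPi]] : exists Pi : 'M[R]_d,
      [/\ \sum_i P i = Pi, Pi^T = Pi, Pi *m Pi = Pi & Y *m Pi = Y].
    exists (U *m U^T); split; [exact: sum_colproj|by rewrite trmx_mul trmxK|
      |exact: dualY_sum].
    by rewrite mulmxA -[U *m U^T *m U]mulmxA UU mulmx1.
  have -> : Y = Pi *m (Y + (1%:M - \sum_i P i)) *m Pi.
    rewrite PiE -mulmxA mulmxDl YPi mulmxBl mul1mx PiPi subrr addr0.
    by rewrite -trmx_dualY -{1}YPi trmx_mul PiT.
  rewrite -!mulmxA mxtrace_mulC -!mulmxA -{1}PiT.
  have := psdmx_congr Pi X1; rewrite -!mulmxA => h.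
  by apply: le_trans (hY _ h); rewrite mulr_ge0 ?psdmx_tr_ge0// ltW.
have SE j : S j = (1%:M - P j) *m (S j + P j) *m (1%:M - P j).
  have SP := dualS_colproj j; have PS : P j *m S j = 0.
    by apply: trmx_inj; rewrite trmx_mul trmx_dualS trmx_colproj SP trmx0.
  have -> : (1%:M - P j) *m (S j + P j) *m (1%:M - P j)
          = (1%:M - P j) *m S j.
    rewrite -mulmxA; congr (_ *m _).
    by rewrite mulmxBr mulmx1 mulmxDl SP add0r colprojM eqxx scale1r addrK.
  by rewrite mulmxBl mul1mx PS subr0.
pose Z j := (1%:M - P j)^T *m X j *m (1%:M - P j).
have trS j : c * \tr (Z j) <= \tr (S j *m X j).
  have -> : \tr (S j *m X j) = \tr ((S j + P j) *m Z j).
    rewrite {1}SE /Z [(1%:M - _)^T]linearB/= trmx1 trmx_colproj -!mulmxA.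
    by rewrite mxtrace_mulC -!mulmxA.
  by apply: hS; exact: psdmx_congr.
have Zpsd j : psdmx (Z j) by exact: psdmx_congr.
(* Optimality of [X] makes the duality gap nonpositive while all its terms are nonnegative, so [Z i]
   has trace zero. *)
have Zi : Z i = 0.
  apply: psdmx_tr0 => //; apply/eqP; rewrite eq_le psdmx_tr_ge0// andbT.
  rewrite -(pmulr_rle0 _ c0); apply: le_trans (trS i) _.
  apply: le_trans gap; rewrite [X in _ <= _ + X](bigD1 i)//= addrCA lerDl.
  rewrite addr_ge0// sumr_ge0// => j _.
  by apply: le_trans (trS j); rewrite mulr_ge0 ?psdmx_tr_ge0// ltW.
(* The diagonal entries of [Z i] are the values of the form [X i] at the columns of [1%:M - P i], so
   [X i] annihilates these columns. *)
have XP : X i *m (1%:M - P i) = 0.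
  apply/matrixP => a b.
  have /matrixP/(_ a 0) : X i *m col b (1%:M - P i) = 0.
    apply: psdmx_form0 => //.
    have := congr1 (fun A : 'M[R]_d => A b b) Zi; rewrite [LHS]mxE [RHS]mxE => h.
    rewrite -[RHS]h.
    rewrite mxE; apply: eq_bigr => j _; rewrite [col _ _ _ _]mxE; congr (_ * _).
    by rewrite !mxE; apply: eq_bigr => l _; rewrite !mxE.
  by rewrite colE mulmxA -colE [LHS]mxE => ->; rewrite !mxE.
have XiE : X i = X i *m P i.
  by apply/eqP; rewrite -subr_eq0 -{1}[X i]mulmx1 -mulmxBr XP.
apply/eqP; rewrite eqn_leq; apply/andP; split.
  rewrite XiE; apply: leq_trans (mxrankM_maxr _ _) _.
  by apply: leq_trans (mxrankM_maxl _ _) _; exact: rank_leq_col.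
rewrite lt0n mxrank_eq0; apply/eqP => Xi0; have := Xtr i.
by rewrite Xi0 mxtrace0 => /esym/eqP; rewrite oner_eq0.
Qed.
End Certificate.
End OrthonormalFrame.

(** * Stationarity of a maximising frame *)

(** Near the origin of the circle [s ^+ 2 + (1 - q) ^+ 2 = 1], [q] is of second order in [s], so a
    positive [b] would make [s * b] dominate for small positive [s]. *)
Lemma le0_first_order (R : realFieldType) (b f e1 e2 e3 : R) :
  (forall s q, s ^+ 2 = 2 * q - q ^+ 2 ->
     s * b + s ^+ 2 * f + q * e1 + s * q * e2 + q ^+ 2 * e3 <= 0) -> b <= 0.
Proof.
move=> h; rewrite leNgt; apply/negP => b0.
(* With [s <= 2 * t] and [q = t * s], the remainder divided by [s] is at most [t * (C - b)] in
   absolute value, and [t * C = b / 2]. The summand [b] makes [C] positive and gives [t <= 1]. *)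
pose C := 2 * `|f| + `|e1| + 2 * `|e2| + 2 * `|e3| + b.
have C0 : 0 < C.
  by rewrite ltr_wpDl// !addr_ge0 ?mulr_ge0.
pose t := b / (2 * C).
have t0 : 0 < t by rewrite divr_gt0// mulr_gt0.
have tC : t * C = b / 2 by rewrite /t; field; lra.
have t1 : t <= 1.
  rewrite ler_pdivrMr ?mulr_gt0// mul1r /C.
  have := normr_ge0 f; have := normr_ge0 e1; have := normr_ge0 e2.
  have := normr_ge0 e3; lra.
(* Rational parametrisation of the circle [s ^+ 2 + (1 - q) ^+ 2 = 1]. *)
pose s := 2 * t / (1 + t ^+ 2); pose q := t * s.
have d0 : 0 < 1 + t ^+ 2 by rewrite ltr_wpDr// sqr_ge0.
have s0 : 0 < s by rewrite divr_gt0// mulr_gt0.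
have st : s <= 2 * t.
  by rewrite ler_pdivrMr//; have := mulr_ge0 (ltW t0) (sqr_ge0 t); lra.
have /h : s ^+ 2 = 2 * q - q ^+ 2 by rewrite /q /s; field; lra.
rewrite (_ : _ + _ = s * (b + s * f + t * e1 + t * s * e2 + t ^+ 2 * s * e3));
  last by rewrite /q; ring.
rewrite pmulr_rle0//; apply/negP; rewrite -ltNge.
have lb (u v x : R) : 0 <= u -> u <= v -> - (v * `|x|) <= u * x.
  move=> u0 uv; have := ler_norm (- x); rewrite normrN => xn.
  have : 0 <= u * (`|x| + x) by rewrite mulr_ge0//; lra.
  have : u * `|x| <= v * `|x| by rewrite ler_wpM2r.
  lra.
have ts : t * s <= s by rewrite ler_piMl// ltW.
have tts : t ^+ 2 * s <= t * s.
  by rewrite expr2 -mulrA ler_piMl// mulr_ge0// ltW.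
have hf : - (2 * t * `|f|) <= s * f by apply: lb => //; exact: ltW.
have he1 : - (t * `|e1|) <= t * e1 by apply: lb => //; exact: ltW.
have he2 : - (2 * t * `|e2|) <= t * s * e2.
  by apply: lb; [rewrite mulr_ge0// ltW|lra].
have he3 : - (2 * t * `|e3|) <= t ^+ 2 * s * e3.
  by apply: lb; [rewrite mulr_ge0 ?sqr_ge0// ltW|lra].
have : t * C = 2 * t * `|f| + t * `|e1| + 2 * t * `|e2| + 2 * t * `|e3| + t * b.
  by rewrite /C; ring.
have : 0 < t * b by exact: mulr_gt0.
rewrite tC; lra.
Qed.

Lemma mxtrace_delta_mul (R : comPzRingType) (d : nat) (a b : 'I_d) (B : 'M[R]_d) :
  \tr (delta_mx a b *m B) = B b a.
Proof.
rewrite /mxtrace (bigD1 a)//= [X in _ + X]big1 ?addr0.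
  rewrite mxE (bigD1 b)//= [X in _ + X]big1 ?addr0.
    by rewrite mxE !eqxx mul1r.
  by move=> c /negbTE cb; rewrite mxE cb andbF mul0r.
move=> c /negbTE ca; rewrite mxE big1// => e _.
by rewrite mxE ca mul0r.
Qed.

Lemma colproj_mul (R : comPzRingType) (d k : nat) (G : 'M[R]_d) (U : 'M[R]_(d, k)) i :
  colproj (G *m U) i = G *m colproj U i *m G^T.
Proof.
rewrite /colproj; have -> : col i (G *m U) = G *m col i U by rewrite !colE mulmxA.
by rewrite trmx_mul !mulmxA.
Qed.

Section FirstOrder.
Context (R : realType) (d k : nat) (N : 'I_k -> 'M[R]_d) (U : 'M[R]_(d, k)).
Hypothesis NT : forall i, (N i)^T = N i.
Hypothesis UU : U^T *m U = 1%:M.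
Hypothesis Umax : forall V : 'M[R]_(d, k), V^T *m V = 1%:M ->
  sdp_obj N (colproj V) <= sdp_obj N (colproj U).

Let P := colproj U.
Let K := \sum_i N i *m P i.
(** [T G G^T] is the objective at the frame [G *m U]; bilinearity allows expanding it in the
    parameters of a rotation [G]. *)
Let T (B C : 'M[R]_d) := \tr (\sum_i N i *m B *m P i *m C).

Let TDl B B' C : T (B + B') C = T B C + T B' C.
Proof.
rewrite /T -mxtraceD -big_split/=; congr (\tr _); apply: eq_bigr => i _.
by rewrite mulmxDr !mulmxDl.
Qed.

Let TDr B C C' : T B (C + C') = T B C + T B C'.
Proof.
rewrite /T -mxtraceD -big_split/=; congr (\tr _); apply: eq_bigr => i _.
by rewrite mulmxDr.
Qed.

Let TZl x B C : T (x *: B) C = x * T B C.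
Proof.
rewrite /T -mxtraceZ scaler_sumr; congr (\tr _); apply: eq_bigr => i _.
by rewrite -scalemxAr -!scalemxAl.
Qed.

Let TZr x B C : T B (x *: C) = x * T B C.
Proof.
rewrite /T -mxtraceZ scaler_sumr; congr (\tr _); apply: eq_bigr => i _.
by rewrite -scalemxAr.
Qed.

(** Rotating the frame in the plane of [a] and [b] changes the objective at rate
    [2 * (K a b - K b a)], which cannot be positive at a maximum. Exchanging [a] and [b] then gives
    the symmetry of [K]. *)
Lemma sum_mul_colproj_le a b : K a b <= K b a.
Proof.
have [->//|ab] := eqVneq a b.
pose A : 'M[R]_d := delta_mx a b - delta_mx b a.
pose D : 'M[R]_d := delta_mx a a + delta_mx b b.
have AT : A^T = - A by rewrite /A linearB/= !trmx_delta opprB.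
have AA : A *m A = - D.
  rewrite /A /D mulmxBl !mulmxBr !mul_delta_mx_cond !eqxx (eq_sym b a) (negbTE ab).
  by rewrite !mulr0n !mulr1n sub0r subr0 opprD.
have DA : D *m A = A.
  rewrite /A /D mulmxDl !mulmxBr !mul_delta_mx_cond !eqxx (eq_sym b a) (negbTE ab).
  by rewrite !mulr0n !mulr1n sub0r subr0.
have AD : A *m D = A.
  apply: oppr_inj; rewrite -mulmxN -AA mulmxA AA mulNmx DA.
  by [].
have DD : D *m D = D.
  by apply: oppr_inj; rewrite -mulmxN -[in LHS]AA mulmxA DA AA.
have DT : D^T = D by rewrite /D linearD/= !trmx_delta.
have : T A 1%:M - T 1%:M A <= 0.
  apply: (@le0_first_order _ _ (- T A A) (- T D 1%:M - T 1%:M D)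
     (T D A - T A D) (T D D)) => s q sq.
  (* [G] rotates the coordinate plane of [a] and [b], with sine [s] and cosine
     [1 - q]. *)
  pose G : 'M[R]_d := 1%:M + s *: A - q *: D.
  have GT : G^T = 1%:M + - s *: A - q *: D.
    rewrite /G linearB/= linearD/= !linearZ/= trmx1 AT DT.
    by rewrite [s *: - A]scalerN [- s *: A]scaleNr.
  have GG : G^T *m G = 1%:M.
    rewrite GT /G !(mulmxDl, mulmxDr, mulmxN, mulNmx, mul1mx, mulmx1).
    rewrite -!(scalemxAl, scalemxAr) AA DA AD DD.
    have cancel (A' D' : 'M[R]_d) :
        1%:M + s *: A' - q *: D' + (- s *: A' + - s *: (s *: - D') - - s *: (q *: A'))
        + (- (q *: D') - q *: (s *: A') - - (q *: (q *: D'))) = 1%:M.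
      apply/matrixP => x y; rewrite !mxE.
      transitivity ((x == y)%:R + (s ^+ 2 - (2 * q - q ^+ 2)) * D' x y); first by ring.
      by rewrite sq subrr mul0r addr0.
    exact: cancel.
  have := @Umax (G *m U).
  rewrite trmx_mul mulmxA -[U^T *m _ *m _]mulmxA GG mulmx1 => /(_ UU).
  have -> : sdp_obj N (colproj (G *m U)) = T G G^T.
    rewrite /sdp_obj /T; congr (\tr _); apply: eq_bigr => i _.
    by rewrite colproj_mul !mulmxA.
  have -> : sdp_obj N (colproj U) = T 1%:M 1%:M.
    by rewrite /sdp_obj /T; congr (\tr _); apply: eq_bigr => i _; rewrite !mulmx1.
  rewrite -subr_le0; apply: le_trans; rewrite le_eqVlt; apply/orP; left.
  rewrite GT /G -!scaleNr !(TDl, TDr, TZl, TZr).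
  by apply/eqP; ring.
have trE (F : 'I_k -> 'M[R]_d) : \tr (\sum_i F i) = \sum_i \tr (F i) by exact: raddf_sum.
have TA1 : T A 1%:M = \tr (A *m K^T).
  rewrite /T /K [(\sum_i _)^T]linear_sum/= mulmx_sumr !trE; apply: eq_bigr => i _.
  by rewrite mulmx1 trmx_mul trmx_colproj NT -mulmxA mxtrace_mulC -!mulmxA.
have T1A : T 1%:M A = \tr (A *m K).
  rewrite /T /K mulmx_sumr !trE; apply: eq_bigr => i _.
  by rewrite mulmx1 mxtrace_mulC.
rewrite TA1 T1A /A !mulmxBl !mxtraceB !mxtrace_delta_mul ![K^T _ _]mxE.
lra.
Qed.

Lemma trmx_sum_mul_colproj : K^T = K.
Proof.
apply/matrixP => a b; rewrite mxE; apply/eqP.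
by rewrite eq_le !sum_mul_colproj_le.
Qed.
End FirstOrder.

(** * Entrywise limits *)

Local Open Scope classical_set_scope.
Local Open Scope ring_scope.

Section EntrywiseConvergence.
Context (R : realType) (T : Type) (F : set_system T) {FF : Filter F}.

(** Entrywise, so that limits of products, transposes and traces reduce to limits in [R]. *)
Definition ecvg (m n : nat) (A : T -> 'M[R]_(m, n)) (L : 'M[R]_(m, n)) :=
  forall a b, A x a b @[x --> F] --> L a b.

Lemma cvg_sumr (I : finType) (f : I -> T -> R) (l : I -> R) :
  (forall i, f i x @[x --> F] --> l i) ->
  \sum_i f i x @[x --> F] --> \sum_i l i.
Proof. by move=> fl; apply: cvg_big => // ; exact: add_continuous. Qed.

Lemma ecvg_cst m n (L : 'M[R]_(m, n)) : ecvg (fun=> L) L.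
Proof. by move=> a b; exact: cvg_cst. Qed.

Lemma ecvgD m n (A B : T -> 'M[R]_(m, n)) L M :
  ecvg A L -> ecvg B M -> ecvg (fun x => A x + B x) (L + M).
Proof.
move=> AL BM a b; rewrite mxE; under eq_cvg do rewrite mxE.
by apply: cvgD.
Qed.

Lemma ecvgB m n (A B : T -> 'M[R]_(m, n)) L M :
  ecvg A L -> ecvg B M -> ecvg (fun x => A x - B x) (L - M).
Proof.
move=> AL BM a b; rewrite !mxE; under eq_cvg do rewrite !mxE.
by apply: cvgB.
Qed.

Lemma ecvgZ m n (t : R) (A : T -> 'M[R]_(m, n)) L :
  ecvg A L -> ecvg (fun x => t *: A x) (t *: L).
Proof.
move=> AL a b; rewrite mxE; under eq_cvg do rewrite mxE.
by apply: cvgM => //; exact: cvg_cst.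
Qed.

Lemma ecvg_mul m n p (A : T -> 'M[R]_(m, n)) (B : T -> 'M[R]_(n, p)) L M :
  ecvg A L -> ecvg B M -> ecvg (fun x => A x *m B x) (L *m M).
Proof.
move=> AL BM a b; rewrite mxE; under eq_cvg do rewrite mxE.
by apply: cvg_sumr => j; apply: cvgM.
Qed.

Lemma ecvg_tr m n (A : T -> 'M[R]_(m, n)) L :
  ecvg A L -> ecvg (fun x => (A x)^T) L^T.
Proof. by move=> AL a b; rewrite mxE; under eq_cvg do rewrite mxE; exact: AL. Qed.

Lemma ecvg_col m n (A : T -> 'M[R]_(m, n)) L i :
  ecvg A L -> ecvg (fun x => col i (A x)) (col i L).
Proof. by move=> AL a b; rewrite mxE; under eq_cvg do rewrite mxE; exact: AL. Qed.

Lemma ecvg_sum m n (I : finType) (A : I -> T -> 'M[R]_(m, n)) L :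
  (forall i, ecvg (A i) (L i)) -> ecvg (fun x => \sum_i A i x) (\sum_i L i).
Proof.
move=> AL a b; rewrite summxE; under eq_cvg do rewrite summxE.
by apply: cvg_sumr => i; apply: AL.
Qed.

Lemma cvg_mxtrace n (A : T -> 'M[R]_n) L :
  ecvg A L -> \tr (A x) @[x --> F] --> \tr L.
Proof. by move=> AL; apply: cvg_sumr => i; exact: AL. Qed.

Lemma ecvg_scalar n (f : T -> R) (l : R) :
  f x @[x --> F] --> l -> ecvg (fun x => (f x)%:M : 'M[R]_n) l%:M.
Proof.
move=> fl a b; rewrite mxE; under eq_cvg do rewrite mxE.
case: eqP => _; last exact: cvg_cst.
exact: fl.
Qed.

Lemma near_pos_diag d (A : T -> 'M[R]_d) (D : 'rV[R]_d) (c : R) :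
  ecvg A (diag_mx D) -> 0 < c -> (forall a, c <= D 0 a) ->
  \forall x \near F, forall X, psdmx X -> c / 2 * \tr X <= \tr (A x *m X).
Proof.
(* This [tau] loses at most [d * tau <= c / 2] of the lower bound [c]; the [+ 1] keeps the
   denominator positive for [d = 0]. *)
move=> AD c0 cD; pose tau := c / (2 * (d%:R + 1)).
have d1 : 0 < d%:R + 1 :> R by rewrite ltr_wpDl.
have tau0 : 0 < tau by rewrite divr_gt0// mulr_gt0.
have nearA : \forall x \near F, forall a b, `|A x a b - D 0 a *+ (a == b)| <= tau.
  apply: filter_forall => a; apply: filter_forall => b.
  have /cvgrPdist_le/(_ _ tau0) := AD a b.
  by apply: filterS => x; rewrite mxE distrC.
apply: filterS nearA => x hx X X0.
apply: le_trans (mxtrace_mul_near_diag hx cD X0).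
rewrite ler_wpM2r ?psdmx_tr_ge0//.
have : d%:R * tau <= c / 2.
  rewrite /tau mulrA ler_pdivrMr ?mulr_gt0//.
  rewrite (_ : c / 2 * _ = (d%:R + 1) * c); last by field.
  by rewrite ler_pM2r// lerDl.
lra.
Qed.

End EntrywiseConvergence.

(** * Existence of maximising frames and perturbation estimates *)

(** The orthonormal frames form a compact set, nonempty by [U0], and the objective is continuous.
    Frames are flattened to row vectors, to which [rV_compact] and [EVT_max_rV] apply. *)
Lemma exists_max_frame (R : realType) (d k : nat) (N : 'I_k -> 'M[R]_d)
    (U0 : 'M[R]_(d, k)) : U0^T *m U0 = 1%:M ->
  exists U : 'M[R]_(d, k), U^T *m U = 1%:M /\
    forall V : 'M[R]_(d, k), V^T *m V = 1%:M ->
      sdp_obj N (colproj V) <= sdp_obj N (colproj U).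
Proof.
move=> U00.
pose S := [set v : 'rV[R]_(d * k) | (vec_mx v)^T *m vec_mx v = 1%:M].
have vec_cvg (v : 'rV[R]_(d * k)) : ecvg (nbhs v) (@vec_mx R d k) (vec_mx v).
  move=> a b; rewrite mxE; under eq_cvg do rewrite mxE.
  exact: coord_continuous.
have Scl : closed S.
  have -> : S = \bigcap_(i in [set: 'I_k]) \bigcap_(j in [set: 'I_k])
      ((fun v => ((vec_mx v)^T *m vec_mx v) i j) @^-1` [set (1%:M : 'M[R]_k) i j]).
    apply/seteqP; split => v /=; first by move=> Sv i _ j _ /=; rewrite Sv.
    by move=> Sv; apply/matrixP => i j; exact: Sv.
  apply: closed_bigI => i _; apply: closed_bigI => j _.
  apply: preimage_closed; last exact: closed_eq.
  by move=> v _; exact: (ecvg_mul (ecvg_tr (vec_cvg v)) (vec_cvg v)).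
have Sco : compact S.
  have box : compact [set v : 'rV[R]_(d * k) | forall i, `[(- 1), 1]%classic (v ord0 i)].
    have := @rV_compact R (d * k) (fun=> [set` `[(- 1 : R), 1]]).
    by apply => _; exact: segment_compact.
  (* Each column has norm one, so its entries lie between -1 and 1. *)
  apply: subclosed_compact Scl box _ => v Sv j /=.
  rewrite in_itv/= -ler_norml; case/mxvec_indexP: j => a b.
  have := congr1 (fun A : 'M[R]_k => A b b) Sv.
  rewrite mxE [RHS]mxE eqxx mulr1n (bigD1 a)//= !mxE => h.
  rewrite -(@ler_pXn2r _ 2)// ?nnegrE// expr1n real_normK ?num_real//.
  rewrite expr2 -h lerDl; apply: sumr_ge0 => l _.
  by rewrite !mxE -expr2 sqr_ge0.
have obj_cvg (v : 'rV[R]_(d * k)) : ecvg (nbhs v)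
    (fun w => \sum_i N i *m colproj (vec_mx w) i) (\sum_i N i *m colproj (vec_mx v) i).
  apply: ecvg_sum => i; apply: ecvg_mul; first exact: ecvg_cst.
  by apply: ecvg_mul; [|apply: ecvg_tr]; apply: ecvg_col; exact: vec_cvg.
have [v /set_mem Sv vmax] : exists2 v, v \in S & forall w, w \in S ->
    sdp_obj N (colproj (vec_mx w)) <= sdp_obj N (colproj (vec_mx v)).
  apply: (EVT_max_rV _ Sco (f := fun w => sdp_obj N (colproj (vec_mx w)))).
    by exists (mxvec U0); rewrite /S/= mxvecK.
  by apply: continuous_subspaceT => v; exact: (cvg_mxtrace (obj_cvg v)).
exists (vec_mx v); split=> // V VV; rewrite -(mxvecK V).
by apply: vmax; rewrite inE /S/= mxvecK.
Qed.

Lemma sdp_obj_diff_le (R : realType) (d k : nat) (M N X : 'I_k -> 'M[R]_d) :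
  (forall i a b, `|X i a b| <= 1) ->
  sdp_obj M X - sdp_obj N X <= \sum_i \sum_a \sum_b `|M i a b - N i a b|.
Proof.
move=> X1; rewrite /sdp_obj -mxtraceB -sumrB /mxtrace.
under eq_bigr do rewrite summxE.
rewrite exchange_big/=; apply: ler_sum => i _; apply: ler_sum => a _.
rewrite -mulmxBl mxE; apply: ler_sum => b _; rewrite !mxE.
apply: le_trans (ler_norm _) _; rewrite normrM.
by rewrite ler_piMr.
Qed.

Lemma exists_pos_lbound (R : realFieldType) (E : finType) (u : E -> R) :
  (forall e, 0 < u e) -> exists c, 0 < c /\ forall e, c <= u e.
Proof.
move=> u0; exists (\big[Order.min/1]_e u e); split.
  by elim/big_ind : _ => // x y x0 y0; rewrite lt_min x0.
by move=> e; rewrite (bigD1 e)//= ge_min lexx.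
Qed.

Lemma colproj_normr_le1 (R : realType) (d k : nat) (U : 'M[R]_(d, k)) i a b :
  U^T *m U = 1%:M -> `|colproj U i a b| <= 1.
Proof.
move=> UU; have P0 := psdmx_colproj U i.
have diag c : colproj U i c c <= 1.
  rewrite -(mxtrace_colproj UU i) /mxtrace (bigD1 c)//= lerDl.
  by apply: sumr_ge0 => e _; exact: psdmx_diag_ge0.
apply: le_trans (psdmx_normr_le a b P0) _.
have := diag a; have := diag b; lra.
Qed.

Lemma colproj_sqr (R : comPzRingType) (d k : nat) (U : 'M[R]_(d, k)) i a b :
  colproj U i a b ^+ 2 = colproj U i a a * colproj U i b b.
Proof. by rewrite /colproj !mxE !big_ord1 !mxE; ring. Qed.

Lemma cvg_sqr0 (R : realType) (T : Type) (F : set_system T) {FF : Filter F}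
    (f : T -> R) : f x ^+ 2 @[x --> F] --> (0 : R) -> f x @[x --> F] --> (0 : R).
Proof.
move=> f0; apply/cvgrPdist_lt => e e0.
have e2 : 0 < e ^+ 2 by rewrite exprn_gt0.
have /cvgrPdist_lt/(_ _ e2) := f0; apply: filterS => x.
rewrite !sub0r !normrN normrX ltr_pXn2r// nnegrE ltW//.
Qed.

(** * Objectives close to a diagonal one *)

Section NearDiagonal.
Context (R : realType) (d k : nat) (m : 'I_k -> 'cV[R]_d) (sigma : 'I_k -> 'I_d)
  (y : 'I_d -> R).
Hypothesis sigma_inj : injective sigma.
Hypothesis y_gt0 : forall i, 0 < y (sigma i).
Hypothesis y_eq0 : forall j, (forall i, sigma i != j) -> y j = 0.
Hypothesis slack_gt0 : forall i j, j != sigma i ->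
  m i j 0 - m i (sigma i) 0 < y j - y (sigma i).

Let Nbar i := diag_mx (m i)^T.
(** The dual slack of the cell [(i, j)]: zero at [j = sigma i], positive elsewhere. *)
Let s i j := y j - y (sigma i) + m i (sigma i) 0 - m i j 0.
Let Ubar : 'M[R]_(d, k) := \matrix_(a, i) (a == sigma i)%:R.
Let E i : 'M[R]_d := delta_mx (sigma i) (sigma i).
Let r i := y (sigma i).

Let s_ge0 i j : 0 <= s i j.
Proof.
have [->|ji] := eqVneq j (sigma i); first by rewrite /s subrr add0r subrr.
by have := slack_gt0 ji; rewrite /s; lra.
Qed.

Let y_ge0 j : 0 <= y j.
Proof.
have [/existsP[i /eqP<-]|/existsPn h] := boolP [exists i, sigma i == j].
  exact: ltW.
by rewrite y_eq0.
Qed.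

Let UUbar : Ubar^T *m Ubar = 1%:M.
Proof.
apply/matrixP => i j; rewrite !mxE.
under eq_bigr do rewrite !mxE.
rewrite (bigD1 (sigma i))//= eqxx mul1r big1 ?addr0.
  by rewrite (inj_eq sigma_inj).
by move=> a /negbTE->; rewrite mul0r.
Qed.

Let colproj_bar i : colproj Ubar i = E i.
Proof.
apply/matrixP => a b; rewrite /colproj !mxE big_ord1 !mxE.
by case: eqP => _; case: eqP => _; rewrite ?(mulr0, mul0r, mulr1).
Qed.

Let diag_mul_E i j :
  Nbar i *m E j = m i (sigma j) 0 *: E j.
Proof.
apply/matrixP => a b; rewrite mul_diag_mx !mxE.
by case: eqP => [->|_]//=; rewrite !mulr0.
Qed.

Let dualY_bar : dualY Nbar E r = diag_mx (\row_j y j).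
Proof.
transitivity (\sum_i y (sigma i) *: E i).
  apply: eq_bigr => i _; rewrite -mulmxA diag_mul_E -scalemxAr mulmxBl mul1mx.
  by rewrite mul_delta_mx subrr scaler0 add0r.
apply/matrixP => a b; rewrite summxE !mxE.
have [/existsP[i /eqP<-]|/existsPn h] := boolP [exists i, sigma i == a].
  rewrite (bigD1 i)//= !mxE eqxx big1 ?addr0.
    by rewrite eq_sym; case: eqP => _; rewrite ?mulr1 ?mulr0.
  move=> j ji; rewrite !mxE (inj_eq sigma_inj) eq_sym (negbTE ji).
  by rewrite mulr0.
rewrite (y_eq0 h) mul0rn big1// => i _.
by rewrite !mxE eq_sym (negbTE (h i)) mulr0.
Qed.

Let dualS_bar i : dualS Nbar E r i = diag_mx (\row_j s i j).
Proof.
rewrite /dualS dualY_bar.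
have -> : \tr (E i *m Nbar i) = m i (sigma i) 0.
  by rewrite mxtrace_mulC diag_mul_E mxtraceZ -colproj_bar mxtrace_colproj// mulr1.
apply/matrixP => a b; rewrite !mxE /r /s.
by case: eqP => [->|_]; rewrite ?mulr1n ?mulr0n; ring.
Qed.

(** At the diagonal objective the dual certificate is diagonal, so a nearly optimal [X i] has little
    diagonal mass away from [sigma i]. *)
Let gap_bar X : sdp_feasible X ->
  \sum_i \sum_j s i j * X i j j <= sdp_obj Nbar E - sdp_obj Nbar X.
Proof.
move=> [X1 Xtr X0].
have EE : E = colproj Ubar by apply/funext => i; rewrite colproj_bar.
rewrite EE (sdp_duality_gap UUbar Nbar r Xtr) -EE dualY_bar.
rewrite -[leLHS]add0r lerD//.
  apply: sumr_ge0 => j _; rewrite mul_diag_mx mxE mxE mulr_ge0//.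
  exact: psdmx_diag_ge0.
apply: ler_sum => i _; rewrite dualS_bar; apply: ler_sum => j _.
by rewrite mul_diag_mx !mxE.
Qed.

Lemma near_diag_sdp_rank_one (T : Type) (F : set_system T) {FF : Filter F}
    (N : T -> 'I_k -> 'M[R]_d) :
  (forall i, ecvg F (N ^~ i) (diag_mx (m i)^T)) ->
  \forall x \near F, (forall i, (N x i)^T = N x i) -> sdp_rank_one_property (N x).
Proof.
move=> Ncvg.
(* The frames are chosen separately for each [x], and their columns may change sign; limits are
   therefore taken of the projections [P x]. *)
have /choice[U hU] : forall x, exists U : 'M[R]_(d, k), U^T *m U = 1%:M /\
    forall V : 'M[R]_(d, k), V^T *m V = 1%:M ->
      sdp_obj (N x) (colproj V) <= sdp_obj (N x) (colproj U).
  by move=> x; exact: exists_max_frame UUbar.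
pose P x := colproj (U x).
pose g x := \sum_i \sum_a \sum_b `|Nbar i a b - N x i a b| +
            \sum_i \sum_a \sum_b `|N x i a b - Nbar i a b|.
have g0 : g x @[x --> F] --> 0.
  have abs0 (f h : T -> R) : f x - h x @[x --> F] --> 0 -> `|f x - h x| @[x --> F] --> 0.
    by move=> fh; rewrite -[X in _ --> X](@normr0 R R); exact: cvg_norm.
  have sum0 (f : T -> 'I_k -> 'I_d -> 'I_d -> R) :
      (forall i a b, f x i a b @[x --> F] --> 0) ->
      \sum_i \sum_a \sum_b f x i a b @[x --> F] --> 0.
    move=> f0; have := cvg_sumr (fun i => cvg_sumr (fun a => cvg_sumr (f0 i a))).
    rewrite (_ : \sum_(i < k) \sum_(a < d) \sum_(b < d) 0 = 0 :> R); first exact.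
    by rewrite big1// => i _; rewrite big1// => a _; rewrite big1.
  rewrite -[X in _ --> X](addr0 0); apply: cvgD; apply: sum0 => i a b; apply: abs0.
    rewrite -[X in _ --> X](subrr (Nbar i a b)).
    by apply: cvgB; [exact: cvg_cst|exact: Ncvg].
  rewrite -[X in _ --> X](subrr (Nbar i a b)).
  by apply: cvgB; [exact: Ncvg|exact: cvg_cst].
(* [P x] is at least as good as [E] for [N x]; passing between [Nbar] and [N x] at [E] and at [P x]
   costs the two sums in [g x]. *)
have gap x i j : s i j * P x i j j <= g x.
  have [UU Umax] := hU x.
  apply: (@le_trans _ _ (sdp_obj Nbar E - sdp_obj Nbar (P x))).
    apply: le_trans (gap_bar (sdp_feasible_colproj UU)).
    rewrite (bigD1 i)//= (bigD1 j)//= -addrA lerDl.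
    by rewrite addr_ge0// sumr_ge0// => [l _|l _]; rewrite ?sumr_ge0// => *;
      rewrite mulr_ge0//; apply: psdmx_diag_ge0; exact: psdmx_colproj.
  have h1 : sdp_obj Nbar E - sdp_obj (N x) E <=
      \sum_i \sum_a \sum_b `|Nbar i a b - N x i a b|.
    by apply: sdp_obj_diff_le => l a b; rewrite -colproj_bar colproj_normr_le1.
  have h2 : sdp_obj (N x) (P x) - sdp_obj Nbar (P x) <=
      \sum_i \sum_a \sum_b `|N x i a b - Nbar i a b|.
    by apply: sdp_obj_diff_le => l a b; rewrite colproj_normr_le1.
  have h3 : sdp_obj (N x) E <= sdp_obj (N x) (P x).
    have -> : E = colproj Ubar by apply/funext => l; rewrite colproj_bar.
    exact: Umax.
  by rewrite /g; lra.
have diag0 i j : j != sigma i -> P x i j j @[x --> F] --> 0.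
  move=> ji; have s0 : 0 < s i j by have := slack_gt0 ji; rewrite /s; lra.
  apply: (@squeeze_cvgr _ _ _ _ (fun=> 0) (fun x => (s i j)^-1 * g x)).
  - near=> x; apply/andP; split; last by rewrite ler_pdivlMl.
    by apply: psdmx_diag_ge0; exact: psdmx_colproj.
  - exact: cvg_cst.
  - by rewrite -(mulr0 (s i j)^-1); apply: cvgM => //; exact: cvg_cst.
have diag1 i : P x i (sigma i) (sigma i) @[x --> F] --> (1 : R).
  have -> : (fun x => P x i (sigma i) (sigma i)) =
      (fun x => 1 - \sum_(j < d) (if j == sigma i then 0 else P x i j j)).
    apply/funext => x; have [UU _] := hU x.
    rewrite -(mxtrace_colproj UU i) /mxtrace (bigD1 (sigma i))//=.
    rewrite [in X in _ - X](bigD1 (sigma i))//= eqxx add0r.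
    rewrite [X in _ - X](eq_bigr (fun j => P x i j j)) ?addrK//.
    by move=> j /negbTE->.
  rewrite -[X in _ --> X]subr0; apply: cvgB; first exact: cvg_cst.
  have off0 j : (if j == sigma i then 0 else P x i j j) @[x --> F] --> 0.
    by case: eqP => [_|/eqP]; [exact: cvg_cst|exact: diag0].
  by have := cvg_sumr off0; rewrite big1//; exact.
(* The projections have rank one, so the square of an off-diagonal entry is a product of two
   diagonal entries, at least one of which tends to zero. *)
have Pcvg i : ecvg F (P ^~ i) (E i).
  have diagc a : P x i a a @[x --> F] --> E i a a.
    by rewrite mxE; case: eqVneq => [->|/diag0//]; exact: diag1.
  move=> a b; have [<-//|ab] := eqVneq a b.
  have -> : E i a b = 0.
    rewrite mxE; case: eqVneq => //= asi; case: eqVneq => //= bsi.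
    by move: ab; rewrite asi bsi eqxx.
  have EE0 : E i a a * E i b b = 0.
    rewrite !mxE !andbb; case: eqVneq => //= asi; last by rewrite mul0r.
    case: eqVneq => //= bsi; last by rewrite mulr0.
    by move: ab; rewrite asi bsi eqxx.
  apply: cvg_sqr0; rewrite -EE0.
  have -> : (fun x => P x i a b ^+ 2) = (fun x => P x i a a * P x i b b).
    by apply/funext => x; rewrite /P colproj_sqr.
  exact: (cvgM (diagc a) (diagc b)).
have Ycvg : ecvg F (fun x => dualY (N x) (P x) r) (dualY Nbar E r).
  have Qcvg i : ecvg F (fun x => 1%:M - P x i) (1%:M - E i).
    by have h := @ecvg_cst R T F FF d d 1%:M; exact: (ecvgB h (Pcvg i)).
  have Tcvg i : ecvg F (fun x => (1%:M - P x i) *m N x i *m P x i + r i *: P x i)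
      ((1%:M - E i) *m Nbar i *m E i + r i *: E i).
    apply: ecvgD; last exact: ecvgZ (Pcvg i).
    exact: (ecvg_mul (ecvg_mul (Qcvg i) (Ncvg i)) (Pcvg i)).
  exact: (ecvg_sum Tcvg).
have Scvg i : ecvg F (fun x => dualS (N x) (P x) r i) (dualS Nbar E r i).
  have trcvg : \tr (P x i *m N x i) - r i @[x --> F] --> \tr (E i *m Nbar i) - r i.
    apply: cvgB; last exact: cvg_cst.
    exact: (cvg_mxtrace (ecvg_mul (Pcvg i) (Ncvg i))).
  have lcvg := @ecvg_scalar R T F FF d _ _ trcvg.
  apply: ecvgB (Ncvg i); exact: (ecvgD Ycvg lcvg).
(* The limits of [Y + (1 - \sum_i P i)] and [S i + P i] are diagonal with these entries. By strict
   complementarity they are positive: the added term is [1] exactly where [y] or [s i] vanishes. *)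
pose DY := \row_j (y j + (1 - \sum_i (j == sigma i)%:R)).
pose DS i := \row_j (s i j + (j == sigma i)%:R).
have [c [c0 [cY cS]]] : exists c, 0 < c /\
    (forall j, c <= DY 0 j) /\ (forall i j, c <= DS i 0 j).
  have DYE j : DY 0 j = if [exists i, sigma i == j] then y j else 1.
    rewrite mxE; case: ifPn => [/existsP[i /eqP<-]|/existsPn h].
      rewrite (bigD1 i)//= eqxx big1 ?addr0 ?subrr ?addr0//.
      by move=> l li; rewrite (inj_eq sigma_inj) eq_sym (negbTE li).
    rewrite (y_eq0 h) big1 ?subr0 ?add0r// => i _.
    by rewrite eq_sym (negbTE (h i)).
  pose u (e : 'I_d + 'I_k * 'I_d) := match e with
    | inl j => DY 0 j | inr (i, j) => DS i 0 j end.
  have [|c [c0 cu]] := @exists_pos_lbound _ _ u.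
    case=> [j|[i j]]; rewrite /u.
      by rewrite DYE; case: ifP => // /existsP[i /eqP<-].
    rewrite mxE; have [->|ji] := eqVneq j (sigma i).
      by rewrite ltr_wpDl.
    by have := slack_gt0 ji; rewrite addr0 /s; lra.
  by exists c; split=> //; split=> [j|i j]; [exact: (cu (inl j))|exact: (cu (inr (i, j)))].
have nearY : \forall x \near F, forall X, psdmx X ->
    c / 2 * \tr X <= \tr ((dualY (N x) (P x) r + (1%:M - \sum_i P x i)) *m X).
  apply: near_pos_diag c0 cY.
  have -> : diag_mx DY = dualY Nbar E r + (1%:M - \sum_i E i).
    rewrite dualY_bar; apply/matrixP => a b; rewrite !mxE summxE.
    case: (eqVneq a b) => [<-|ab]; rewrite ?mulr1n ?mulr0n.
      congr (_ + (_ - _)); apply: eq_bigr => i _; by rewrite mxE andbb.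
    rewrite big1 ?subr0 ?addr0// => i _; rewrite mxE.
    case: eqVneq => //= asi; case: eqVneq => //= bsi.
    by move: ab; rewrite asi bsi eqxx.
  apply: ecvgD => //; apply: ecvgB; first exact: ecvg_cst.
  exact: ecvg_sum.
have nearS : \forall x \near F, forall i X, psdmx X ->
    c / 2 * \tr X <= \tr ((dualS (N x) (P x) r i + P x i) *m X).
  apply: filter_forall => i; apply: near_pos_diag c0 (cS i).
  have -> : diag_mx (DS i) = dualS Nbar E r i + E i.
    rewrite dualS_bar; apply/matrixP => a b; rewrite !mxE.
    case: (eqVneq a b) => [<-|ab]; rewrite ?mulr1n ?mulr0n ?andbb//.
    rewrite (_ : _ && _ = false) ?addr0//.
    by apply/negP => /andP[/eqP asi /eqP bsi]; rewrite asi bsi eqxx in ab.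
  exact: ecvgD.
near=> x => NT; have [UU Umax] := hU x.
apply: (@sdp_rank_one_of_certificate _ _ _ _ UU _ r NT _ (c / 2)).
- exact: trmx_sum_mul_colproj.
- by rewrite divr_gt0.
- by near: x.
- by near: x.
Unshelve. all: by end_near.
Qed.
End NearDiagonal.

(** * Neighborhoods in the space of tuples *)

Lemma psdmxD (R : realType) (d : nat) (A B : 'M[R]_d) :
  psdmx A -> psdmx B -> psdmx (A + B).
Proof.
move=> [AT A0] [BT B0]; split; first by rewrite linearD/= AT BT.
by move=> v; rewrite mulmxDr mulmxDl mxE addr_ge0.
Qed.

Lemma psdmxZ (R : realType) (d : nat) (t : R) (A : 'M[R]_d) :
  0 <= t -> psdmx A -> psdmx (t *: A).
Proof.
move=> t0 [AT A0]; split; first by rewrite linearZ/= AT.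
by move=> v; rewrite -scalemxAr -scalemxAl mxE mulr_ge0.
Qed.

Lemma near_psdmx (R : realType) (T : Type) (F : set_system T) {FF : Filter F}
    (d : nat) (A : T -> 'M[R]_d) (c : R) :
  0 < c -> ecvg F A c%:M ->
  \forall x \near F, (A x)^T = A x -> psdmx (A x).
Proof.
move=> c0 Ac; have : ecvg F A (diag_mx (const_mx c)) by rewrite diag_const_mx.
move=> /near_pos_diag/(_ c0).
have le_c (a : 'I_d) : c <= (const_mx c : 'rV_d) 0 a by rewrite mxE.
move=> /(_ le_c); apply: filterS => x hx AT; split=> // v.
have v0 := psdmx_gram v.
have -> : (v^T *m A x *m v) 0 0 = \tr (A x *m (v *m v^T)).
  by rewrite mulmxA mxtrace_mulC mulmxA /mxtrace big_ord1.
apply: le_trans (hx _ v0).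
by apply: mulr_ge0; [rewrite divr_ge0// ltW|exact: psdmx_tr_ge0].
Qed.

Lemma sdp_feasible_congr (R : realType) (k d : nat) (Q : 'M[R]_d)
    (X : 'I_k -> 'M[R]_d) : orthogonal_mx Q -> sdp_feasible X ->
  sdp_feasible (fun i => Q^T *m X i *m Q).
Proof.
move=> QQ [X1 Xtr X0]; split=> [|i|i].
- rewrite /lemx -mulmx_suml -mulmx_sumr.
  have -> : 1%:M - Q^T *m (\sum_i X i) *m Q = Q^T *m (1%:M - \sum_i X i) *m Q.
    by rewrite mulmxBr mulmxBl mulmx1 QQ.
  exact: psdmx_congr.
- by rewrite mxtrace_mulC mulmxA (mulmx1C QQ) mul1mx.
- exact: psdmx_congr.
Qed.

Lemma sdp_obj_congr (R : realType) (k d : nat) (Q : 'M[R]_d)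
    (M X : 'I_k -> 'M[R]_d) : orthogonal_mx Q ->
  sdp_obj (fun i => Q^T *m M i *m Q) (fun i => Q^T *m X i *m Q) = sdp_obj M X.
Proof.
move=> QQ; have QQ' := mulmx1C QQ.
rewrite /sdp_obj; under eq_bigr => i _.
  have -> : Q^T *m M i *m Q *m (Q^T *m X i *m Q) = Q^T *m (M i *m X i) *m Q.
    by rewrite !mulmxA -[_ *m Q *m Q^T]mulmxA QQ' mulmx1.
  over.
by rewrite -mulmx_suml -mulmx_sumr mxtrace_mulC mulmxA QQ' mul1mx.
Qed.

(** Conjugation by [Q] is a bijection of the feasible set that preserves the objective and the
    rank. *)
Lemma sdp_rank_one_congr (R : realType) (k d : nat) (Q : 'M[R]_d)
    (M : 'I_k -> 'M[R]_d) : orthogonal_mx Q ->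
  sdp_rank_one_property (fun i => Q^T *m M i *m Q) -> sdp_rank_one_property M.
Proof.
move=> QQ rk1 X [Xfeas Xopt] i.
have QQ' := mulmx1C QQ.
have QTorth : orthogonal_mx Q^T by rewrite /orthogonal_mx trmxK.
have congrK (Y : 'M[R]_d) : Q^T *m (Q *m Y *m Q^T) *m Q = Y.
  by rewrite !mulmxA QQ mul1mx -mulmxA QQ mulmx1.
have /rk1/(_ i) rkX : sdp_optimal (fun i => Q^T *m M i *m Q)
    (fun i => Q^T *m X i *m Q).
  split=> [|Y Yfeas]; first exact: sdp_feasible_congr.
  have YE : Y = fun i => Q^T *m (Q *m Y i *m Q^T) *m Q.
    by apply/funext => j; rewrite congrK.
  rewrite YE !sdp_obj_congr//; apply: Xopt.
  by have := sdp_feasible_congr QTorth Yfeas; rewrite trmxK.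
apply/eqP; rewrite eqn_leq; apply/andP; split.
  have -> : X i = Q *m (Q^T *m X i *m Q) *m Q^T.
    by rewrite !mulmxA QQ' mul1mx -mulmxA QQ' mulmx1.
  by rewrite -[leqRHS]rkX (leq_trans (mxrankM_maxl _ _))// mxrankM_maxr.
by rewrite -[leqLHS]rkX (leq_trans (mxrankM_maxl _ _))// mxrankM_maxr.
Qed.

Lemma ptws_cvg (I : Type) (V : topologicalType) (F : set_system {ptws I -> V})
    (f : {ptws I -> V}) : Filter F ->
  (forall i, g i @[g --> F] --> f i) -> F --> f.
Proof.
move=> FF Ff; apply/cvg_sup => i; apply/cvg_image.
  by rewrite eqEsubset; split=> v // _; exists (cst v).
apply: cvg_trans (Ff i) => W /=; rewrite nbhs_simpl; exists (@^~ i @^-1` W) => //.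
by rewrite image_preimage // eqEsubset; split=> // j _; exists (fun _ => j).
Qed.

Lemma mxtuple_entry_cvg (R : realType) (k d : nat) (M0 : mxtuple R k d) i :
  ecvg (nbhs M0) (fun M : mxtuple R k d => M i) (M0 i).
Proof.
move=> a b; have pc : proj i M @[M --> M0] --> M0 i.
  exact: (@proj_continuous 'I_k (fun=> 'M[R]_d) i M0).
exact: (cvg_comp _ _ pc (@coord_continuous _ _ _ a b (M0 i))).
Qed.

(** [Mbar] may lie on the boundary of [coefset], so an interior point is found by moving slightly
    towards its centre, the tuple of matrices [(mu / 2)%:M]. *)
Lemma coefset_full_dim_nbhd (R : realType) (k d : nat) (mu : R)
    (Mbar : mxtuple R k d) (A : set (mxtuple R k d)) :
  0 < mu -> coefset k d mu Mbar -> nbhs Mbar A ->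
  full_dim_nbhd (coefset k d mu) Mbar (coefset k d mu `&` A^°).
Proof.
move=> mu0 Mbar_in nA; split=> [M MC i|M []//|||].
- by case: (MC i).
- by split=> //; exact: nA.
- apply/open_subspaceP; exists A^°; first exact: open_interior.
  by apply/seteqP; split=> M; rewrite /setI/=; tauto.
pose Pt (t : R) : mxtuple R k d := fun i => (1 - t) *: Mbar i + t *: (mu / 2)%:M.
have Ptcvg : Pt t @[t --> (0 : R)] --> Mbar.
  apply: ptws_cvg => [|i]; first exact: fmap_filter.
  have h : (1 - t) *: Mbar i + t *: (mu / 2)%:M @[t --> (0 : R)] -->
      (1 - 0) *: Mbar i + 0 *: ((mu / 2)%:M : 'M[R]_d).
    apply: cvgD; apply: cvgZr_tmp; last exact: cvg_id.
    by apply: cvgB; [exact: cvg_cst|exact: cvg_id].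
  by move: h; rewrite subr0 scale1r scale0r addr0.
have [t [t0 t1 At]] : exists t, [/\ 0 < t, t < 1 & A^° (Pt t)].
  have : \forall t \near (0 : R), A^° (Pt t).
    by apply: Ptcvg; apply: open_nbhs_nbhs; split; [exact: open_interior|exact: nA].
  move=> /(cvg_at_right_filter (@cvg_id _ _)) nearAt.
  near (0 : R)^'+ => t; exists t; split; near: t.
  - exact: nbhs_right_gt.
  - exact: nbhs_right_lt.
  - exact: nearAt.
have tmu : 0 < t * (mu / 2) by rewrite mulr_gt0// divr_gt0.
have Ptsym : symtuples R k d (Pt t).
  move=> i; case: (Mbar_in i) => MT _ _.
  by rewrite /Pt linearD/= !linearZ/= MT tr_scalar_mx.
exists (Pt t).
suff : within (symtuples R k d) (nbhs (Pt t)) (coefset k d mu `&` A^°).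
  by rewrite (nbhs_subspace_in Ptsym).
rewrite /within/=.
(* For [M] near [Pt t], the difference [M i - (1 - t) *: Mbar i] is close to [(t * (mu / 2))%:M],
   hence between [0] and [(t * mu)%:M]. Adding [(1 - t) *: Mbar i], which lies between [0] and
   [((1 - t) * mu)%:M], puts [M i] between [0] and [mu%:M]. *)
have Mcvg i : ecvg (nbhs (Pt t)) (fun M : mxtuple R k d => M i - (1 - t) *: Mbar i)
    (t * (mu / 2))%:M.
  have -> : (t * (mu / 2))%:M = Pt t i - (1 - t) *: Mbar i.
    by rewrite /Pt addrAC subrr add0r scale_scalar_mx.
  by apply: ecvgB; [exact: mxtuple_entry_cvg|exact: ecvg_cst].
have lower : \forall M \near Pt t, forall i,
    (M i - (1 - t) *: Mbar i)^T = M i - (1 - t) *: Mbar i ->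
    psdmx (M i - (1 - t) *: Mbar i).
  exact: (filter_forall _ (fun i => near_psdmx tmu (Mcvg i))).
have upper : \forall M \near Pt t, forall i,
    ((t * mu)%:M - (M i - (1 - t) *: Mbar i))^T = (t * mu)%:M - (M i - (1 - t) *: Mbar i) ->
    psdmx ((t * mu)%:M - (M i - (1 - t) *: Mbar i)).
  have Ucvg i : ecvg (nbhs (Pt t))
      (fun M : mxtuple R k d => (t * mu)%:M - (M i - (1 - t) *: Mbar i))
      ((t * mu)%:M - (t * (mu / 2))%:M).
    by apply: ecvgB; [exact: ecvg_cst|exact: Mcvg].
  have mu2 : (t * mu)%:M - (t * (mu / 2))%:M = (t * (mu / 2))%:M :> 'M[R]_d.
    by rewrite -raddfB/=; congr (_%:M); field.
  rewrite mu2 in Ucvg; exact: (filter_forall _ (fun i => near_psdmx tmu (Ucvg i))).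
have nearA : \forall M \near Pt t, A^° M.
  by apply: open_nbhs_nbhs; split=> //; exact: open_interior.
near=> M => MT.
split; last by near: M.
move=> i; have [MbT Mb0 Mb1] := Mbar_in i.
have DT : (M i - (1 - t) *: Mbar i)^T = M i - (1 - t) *: Mbar i.
  by rewrite linearB/= linearZ/= MT MbT.
split=> //; rewrite /lemx.
  rewrite subr0 -[M i](subrK ((1 - t) *: Mbar i)).
  apply: psdmxD; first by move: i DT {Mb0 Mb1 MbT}; near: M.
  apply: psdmxZ; first by rewrite subr_ge0 ltW.
  by move: Mb0; rewrite /lemx subr0.
rewrite (_ : _ - _ = ((t * mu)%:M - (M i - (1 - t) *: Mbar i)) + (1 - t) *: (mu%:M - Mbar i)).
  apply: psdmxD; last by apply: psdmxZ => //; rewrite subr_ge0 ltW.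
  have : ((t * mu)%:M - (M i - (1 - t) *: Mbar i))^T = (t * mu)%:M - (M i - (1 - t) *: Mbar i).
    by rewrite linearB/= tr_scalar_mx DT.
  by move: i {DT Mb0 Mb1 MbT}; near: M.
apply/matrixP => a b; rewrite !mxE.
by case: eqP => _; rewrite ?mulr1n ?mulr0n; ring.
Unshelve. all: by end_near.
Qed.

Theorem theorem4p6 (R : realType) (k d : nat) (mu : R)
    (k_lt_d : (k < d)%N) (mu_gt0 : 0 < mu)
    (Mbar : 'I_k -> 'M[R]_d) (Mbar_in : coefset k d mu Mbar)
    (Q : 'M[R]_d) (mbar : 'I_k -> 'cV[R]_d)
    (Mbar_diag : jointly_diagonalized Mbar Q mbar)
    (lp_uniq : exists! x : 'I_k -> 'cV[R]_d, lp_optimal mbar x) :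
  exists N : set (mxtuple R k d),
    full_dim_nbhd (coefset k d mu) Mbar N /\
    (forall M : 'I_k -> 'M[R]_d, N M -> sdp_rank_one_property M).
Proof.
have [x [xopt xuniq]] := lp_uniq; have [QQ QM] := Mbar_diag.
have [sigma [y [sinj ypos yzero slack]]] := lp_strict_dual xopt xuniq.
pose conjQ (M : mxtuple R k d) (i : 'I_k) := Q^T *m M i *m Q.
have conjcvg i : ecvg (nbhs (Mbar : mxtuple R k d)) (conjQ ^~ i) (diag_mx (mbar i)^T).
  rewrite -QM; apply: ecvg_mul; last exact: ecvg_cst.
  by apply: ecvg_mul; [exact: ecvg_cst|exact: mxtuple_entry_cvg].
have nearQ := near_diag_sdp_rank_one sinj ypos yzero slack conjcvg.
(* The interior is taken among all tuples, including nonsymmetric ones, so symmetry appears as an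
   antecedent, which membership in [coefset] discharges. *)
exists (coefset k d mu `&` [set M | (forall i, (conjQ M i)^T = conjQ M i) ->
  sdp_rank_one_property (conjQ M)]^°).
split; first by apply: (coefset_full_dim_nbhd mu_gt0 Mbar_in); exact: nearQ.
move=> M [MC /interior_subset/= h].
apply: sdp_rank_one_congr QQ (h _) => i; case: (MC i) => MT _ _.
by rewrite /conjQ !trmx_mul trmxK MT mulmxA.
Qed.
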